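(* Let $\ell\ge2$ be fixed, let $f$ be a computable function of $\ell$ arguments, and let $\Pi=(\mathcal R,t)$ be an $\ell$-party nondeterministic protocol on domain $D=\{0,1\}^{n_1}\times\cdots\times\{0,1\}^{n_\ell}$ that computes $f$. Then for every $(x_1,\dots,x_\ell)\in D$, $$C(\tilde t\mid\Pi)\ \ge\ \frac{1}{\ell-1}\Big(\sum_{i=1}^{\ell}C(\tilde f\mid x_i,\Pi)+\sum_{i=1}^{\ell}C(\tilde t\mid x_i,\tilde f,\Pi)-\log\rho(\tilde t)\Big) - O(\log n),$$ where $\tilde t=t(x_1,\dots,x_\ell)$, $\tilde f=f(x_1,\dots,x_\ell)$, and $n$ is the maximum length of the strings involved.
   Context: Fix a universal Turing machine $U$. $C(x\mid u)$ is the length of a shortest $p$ with $U(p,u)=x$; tuples and finite objects are encoded as strings by fixed computable encodings. A rectangle in $D$ is a set of the form $S_1\times\cdots\times S_\ell$ with $S_i\subseteq\{0,1\}^{n_i}$. An $\ell$-party (nondeterministic) protocol $\Pi=(\mathcal R,t)$ consists of a finite set $\mathcal R$ of rectangles whose union contains $D$, and a function $t$ assigning to each tuple $(x_1,\dots,x_\ell)\in D$ a rectangle of $\mathcal R$ containing it. $\Pi$ is regarded as a finite object, and a rectangle $t(x_1,\dots,x_\ell)$ is identified with a string encoding its index in $\mathcal R$. $\Pi$ computes $f$ if $f$ is constant on every rectangle of $\mathcal R$. The thickness of a cell is the number of rectangles of $\mathcal R$ containing it; the thickness $\rho(R)$ of a rectangle $R$ is the maximum thickness of its cells. *)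

(* Defs.v *)
From HB Require Import structures.
From mathcomp Require Import all_boot all_order all_algebra.
From mathcomp Require Import boolp reals exp.

Set Implicit Arguments.
Unset Strict Implicit.
Unset Printing Implicit Defensive.

Import Order.TTheory GRing.Theory Num.Theory.

Definition bits := seq bool.

(** * Turing machines *)

(* Tape alphabet {0, 1, blank}; [None] is the blank. *)
Definition sym := option bool.

Inductive move := MoveLeft | Stay | MoveRight.

(* A two-way infinite tape. The first list holds the cells to the left of the
   head, nearest first; the second one starts with the scanned cell. All cells
   beyond the two lists are blank. *)
Definition tape := (seq sym * seq sym)%type.

Definition tape_of_bits (w : bits) : tape := ([::], map Some w).

Definition tape_read (a : tape) : sym := head None a.2.

Definition tape_write (s : sym) (a : tape) : tape := (a.1, s :: behead a.2).

Definition tape_move (m : move) (a : tape) : tape :=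
  match m with
  | MoveLeft => (behead a.1, head None a.1 :: a.2)
  | Stay => a
  | MoveRight => (head None a.2 :: a.1, behead a.2)
  end.

(* The word that starts at the head and ends before the first blank. *)
Definition tape_word (a : tape) : bits :=
  (fix word (r : seq sym) : bits :=
     if r is Some b :: r' then b :: word r' else [::]) a.2.

Lemma tape_of_bitsK : cancel tape_of_bits tape_word.
Proof. by rewrite /tape_word /=; elim=> //= b w ->. Qed.

(* Deterministic machines with [tm_tapes.+1] tapes; the machine halts when the
   transition function returns [None]. *)
Record TM := MakeTM {
  tm_tapes : nat;
  tm_state : finType;
  tm_start : tm_state;
  tm_delta : tm_state -> {ffun 'I_tm_tapes.+1 -> sym} ->
             option (tm_state * {ffun 'I_tm_tapes.+1 -> sym * move})
}.

Definition config (M : TM) : Type :=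
  (tm_state M * {ffun 'I_(tm_tapes M).+1 -> tape})%type.

(* The j-th argument is on tape j; the remaining tapes are blank. *)
Definition tm_init (M : TM) (ws : seq bits) : config M :=
  (tm_start M, [ffun j : 'I_(tm_tapes M).+1 => tape_of_bits (nth [::] ws j)]).

Definition tm_step (M : TM) (c : config M) : option (config M) :=
  if tm_delta c.1 [ffun j => tape_read (c.2 j)] is Some (q, act) then
    Some (q, [ffun j => tape_move (act j).2 (tape_write (act j).1 (c.2 j))])
  else None.

Definition tm_output (M : TM) (c : config M) : bits := tape_word (c.2 ord0).

Fixpoint tm_run (M : TM) (k : nat) (c : config M) : option bits :=
  if tm_step c is Some c' then
    if k is k'.+1 then tm_run k' c' else None
  else Some (tm_output c).

(* M halts on arguments ws with output w. *)
Definition tm_eval (M : TM) (ws : seq bits) (w : bits) : Prop :=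
  exists k, tm_run k (tm_init M ws) = Some w.

Definition computable (l : nat) (f : l.-tuple bits -> bits) : Prop :=
  exists M : TM, forall xs : l.-tuple bits, tm_eval M xs (f xs).

(** * Kolmogorov complexity *)

(* Universality in the sense of Kolmogorov and Solomonoff: U simulates every
   two-argument machine V with a constant overhead in the program length. It
   holds in particular if U(hp, u) = V(p, u) for some string h = h(V). *)
Definition universal (U : TM) : Prop :=
  forall V : TM, exists c : nat, forall p u x : bits,
    tm_eval V [:: p; u] x ->
    exists2 q : bits, (size q <= size p + c)%N & tm_eval U [:: q; u] x.

Record universalTM := UniversalTM {
  utm :> TM;
  utm_universal : universal utm
}.

Lemma universalTM_program (U : universalTM) (x u : bits) :
  exists k : nat, `[< exists2 p : bits, size p = k & tm_eval U [:: p; u] x >].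
Proof.
pose V := @MakeTM 0 unit tt (fun _ _ => None).
have [c /(_ x u x) cP] := utm_universal U V.
have Vx : tm_eval V [:: x; u] x.
  exists 0; rewrite /= /tm_output /tm_init /= ffunE /=.
  by rewrite [X in Some X]tape_of_bitsK.
have [q _ qx] := cP Vx.
by exists (size q); apply/asboolP; exists q.
Qed.

(* C(x | u), the length of a shortest p with U(p, u) = x. *)
Definition C (U : universalTM) (x u : bits) : nat :=
  ex_minn (universalTM_program U x u).

(** * Encodings *)

(* Self-delimiting code: a 1 before every bit, and a final 0. *)
Definition code_bits (w : bits) : bits :=
  rcons (flatten [seq [:: true; b] | b <- w]) false.

Definition code_seq (ws : seq bits) : bits := flatten (map code_bits ws).

(* Binary digits, least significant first. *)
Definition code_nat (k : nat) : bits :=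
  [seq odd (k %/ 2 ^ j) | j <- iota 0 (trunc_log 2 k).+1].

(** * Protocols *)

(* {0,1}^(n_1) x ... x {0,1}^(n_l) *)
Definition dom (l : nat) (n : 'I_l -> nat) : finType :=
  {dffun forall i : 'I_l, (n i).-tuple bool}.

Definition strings (l : nat) (n : 'I_l -> nat) (x : dom n) : l.-tuple bits :=
  [tuple tval (x i) | i < l].

Definition rectangle (l : nat) (n : 'I_l -> nat) (B : {set dom n}) : Prop :=
  exists A : forall i : 'I_l, {set (n i).-tuple bool}, B = setXn A.

(* The finite set of rectangles is given with an enumeration, which fixes the
   indices of the rectangles. *)
Record protocol (l : nat) (n : 'I_l -> nat) := Protocol {
  rects : seq {set dom n};
  rects_uniq : uniq rects;
  rects_rectangle : forall B, B \in rects -> rectangle B;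
  rects_cover : forall x : dom n, exists2 B, B \in rects & x \in B;
  transcript : dom n -> {set dom n};
  transcript_rects : forall x, transcript x \in rects;
  transcript_mem : forall x, x \in transcript x
}.

Section Protocol.
Variables (l : nat) (n : 'I_l -> nat) (Pi : protocol n).

Definition computes (f : l.-tuple bits -> bits) : Prop :=
  forall B : {set dom n}, B \in rects Pi ->
  forall x y : dom n, x \in B -> y \in B -> f (strings x) = f (strings y).

Definition cell_thickness (x : dom n) : nat :=
  count (fun B : {set dom n} => x \in B) (rects Pi).

Definition thickness (B : {set dom n}) : nat :=
  \max_(x in B) cell_thickness x.

(* The string identified with a rectangle B of the protocol. *)
Definition code_index (B : {set dom n}) : bits :=
  code_nat (index B (rects Pi)).

Definition code_cell (x : dom n) : bits := code_seq (strings x).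

Definition code_rect (B : {set dom n}) : bits :=
  code_seq [seq code_cell x | x <- enum B].

(* The list of the rectangles, followed by the table of t. *)
Definition code_protocol : bits :=
  code_seq
    [:: code_seq [seq code_rect B | B <- rects Pi];
        code_seq [seq code_seq [:: code_cell x; code_index (transcript Pi x)]
                 | x <- enum (dom n)]].

End Protocol.

Local Open Scope ring_scope.

Definition log2 (R : realType) (x : R) : R := ln x / ln 2.

(* Main.v *)
(** Put [k = C(t|P)], [b_i = C(y|x_i,P)], [d_i = C(t|x_i,y,P)], and let [S_i(T)] be
    the projections of a rectangle [T]. Enumerate the rectangles of complexity at
    most [k] given [P]; there are at most [2^k] of them. For each [i], run an online
    multiplicative-weights process on the strings of length [n_i] with rate [2^-a],
    where [a = a_i] is [b_i + d_i] minus a logarithmic slack: an arriving rectangle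
    whose projection [S_i] has relative weight below [2^(a-k)] is "uncovered", and
    then the weights on [S_i] are multiplied by [1 + 2^-a]. The total weight at most
    doubles, and a string lies in at most [2^a * poly(n)] uncovered rectangles. If [t]
    were uncovered for some [i], then either few uncovered rectangles containing
    [x_i] carry the value [y], so that [C(t|x_i,y,P) < d_i], or [y] is one of few
    frequent values, so that [C(y|x_i,P) < b_i]. Hence [t] is covered for every [i],
    that is, its product weight is at least [prod_i 2^(a_i-k)]; since a cell lies in
    at most [rho] rectangles of thickness at most [rho], only about
    [rho * prod_i 2^(k-a_i)] rectangles of that thickness are covered. The index of
    [t] among these gives [k <= log rho + sum_i (k - a_i) + O(log n)].

    All three enumerations must be carried out by Turing machines. Stack programs are
    compiled to machines, data are encoded as binary trees kept on a stack, and the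
    functions computed in this way are closed under pairing, branching, folds and
    unbounded search, which is enough to simulate [U] and the machine of [f]. *)

Require Import Defs.
From HB Require Import structures.
From mathcomp Require Import all_boot all_order all_algebra.
From mathcomp Require Import boolp reals exp.
From mathcomp Require Import zify lra.

Set Implicit Arguments.
Unset Strict Implicit.
Unset Printing Implicit Defensive.

(** * Stack programs and their compilation to Turing machines *)

Section TMReach.
Variable M : TM.
Implicit Types c : config M.

(** Phrased through the fuel of [tm_run], so that runs compose by adding step counts and the final
    output is carried along. *)
Definition tm_reach c c' : Prop := exists n, forall k, tm_run (n + k) c = tm_run k c'.

Lemma tm_reach_refl c : tm_reach c c.
Proof. by exists 0. Qed.

Lemma tm_reach_trans c c' c'' : tm_reach c c' -> tm_reach c' c'' -> tm_reach c c''.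
Proof.
by move=> [n1 H1] [n2 H2]; exists (n1 + n2) => k; rewrite -addnA H1 H2.
Qed.

Lemma tm_reach_step c c' : tm_step c = Some c' -> tm_reach c c'.
Proof. by move=> H; exists 1 => k; rewrite add1n /= H. Qed.

Lemma tm_reach_halt c c' :
  tm_reach c c' -> tm_step c' = None -> exists k, tm_run k c = Some (tm_output c').
Proof. by move=> [n H] H'; exists (n + 0); rewrite H /= H'. Qed.

End TMReach.

Inductive cmd :=
| Skip
| Push of nat & bool
| Seq of cmd & cmd
| Case of nat & cmd & cmd & cmd
| Loop of nat & cmd & cmd.

Notation stacks := (seq bits).

Definition upd (s : stacks) i w : stacks := set_nth [::] s i w.

(* [Case i ce c0 c1] pops stack [i] and branches on the outcome (empty, 0, 1);
   [Loop i c0 c1] pops stack [i] and runs [c0] or [c1] until it is empty. *)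
Inductive exec : cmd -> stacks -> stacks -> Prop :=
| ExSkip s : exec Skip s s
| ExPush i b s : exec (Push i b) s (upd s i (b :: nth [::] s i))
| ExSeq c1 c2 s1 s2 s3 : exec c1 s1 s2 -> exec c2 s2 s3 -> exec (Seq c1 c2) s1 s3
| ExCaseE i ce c0 c1 s s' : nth [::] s i = [::] ->
    exec ce s s' -> exec (Case i ce c0 c1) s s'
| ExCaseB i ce c0 c1 s s' b w : nth [::] s i = b :: w ->
    exec (if b then c1 else c0) (upd s i w) s' -> exec (Case i ce c0 c1) s s'
| ExLoopE i c0 c1 s : nth [::] s i = [::] -> exec (Loop i c0 c1) s s
| ExLoopB i c0 c1 s s' s'' b w : nth [::] s i = b :: w ->
    exec (if b then c1 else c0) (upd s i w) s' ->
    exec (Loop i c0 c1) s' s'' -> exec (Loop i c0 c1) s s''.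

Inductive instr :=
| IPush of nat & bool
| IPop of nat & nat & nat & nat
| IJmp of nat.

Fixpoint clen (c : cmd) : nat :=
  match c with
  | Skip => 0
  | Push _ _ => 1
  | Seq c1 c2 => clen c1 + clen c2
  | Case _ ce c0 c1 => (clen ce + (clen c0 + clen c1).+2).+1
  | Loop _ c0 c1 => (clen c0 + (clen c1).+1).+2
  end.

(* The code of [c], to be placed at address [p]. *)
Fixpoint compile (p : nat) (c : cmd) : seq instr :=
  match c with
  | Skip => [::]
  | Push i b => [:: IPush i b]
  | Seq c1 c2 => compile p c1 ++ compile (p + clen c1) c2
  | Case i ce c0 c1 =>
      let p0 := p + (clen ce).+2 in
      let p1 := p0 + (clen c0).+1 in
      let q := p1 + clen c1 in
      IPop i p.+1 p0 p1 :: compile p.+1 ce ++ IJmp q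
        :: compile p0 c0 ++ IJmp q :: compile p1 c1
  | Loop i c0 c1 =>
      let p1 := p + (clen c0).+2 in
      let q := p1 + (clen c1).+1 in
      IPop i q p.+1 p1 :: compile p.+1 c0 ++ IJmp p :: compile p1 c1 ++ [:: IJmp p]
  end.

Lemma size_compile p c : size (compile p c) = clen c.
Proof.
elim: c p => //= [c1 IH1 c2 IH2|i ce IHe c0 IH0 c1 IH1|i c0 IH0 c1 IH1] p.
- by rewrite size_cat IH1 IH2.
- by rewrite size_cat /= size_cat /= IHe IH0 IH1; lia.
- by rewrite size_cat /= size_cat /= IH0 IH1; lia.
Qed.

Definition code_at (code : seq instr) (p : nat) (c : seq instr) : Prop :=
  exists pre post, code = pre ++ c ++ post /\ size pre = p.

Lemma code_at_nth code p ins c : code_at code p (ins :: c) ->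
  p < size code /\ nth (IJmp 0) code p = ins.
Proof.
move=> [pre [post [-> <-]]]; rewrite size_cat /= nth_cat ltnn subnn /=.
by split=> //; rewrite -addSnnS leq_addr.
Qed.

Lemma code_at_catl code p c1 c2 : code_at code p (c1 ++ c2) -> code_at code p c1.
Proof.
by move=> [pre [post [-> <-]]]; exists pre, (c2 ++ post); rewrite -!catA.
Qed.

Lemma code_at_catr code p c1 c2 :
  code_at code p (c1 ++ c2) -> code_at code (p + size c1) c2.
Proof.
move=> [pre [post [-> <-]]]; exists (pre ++ c1), post.
by rewrite size_cat !catA.
Qed.

Lemma code_at_tail code p ins c : code_at code p (ins :: c) -> code_at code p.+1 c.
Proof. by rewrite -cat1s => /code_at_catr; rewrite addn1. Qed.

Section Compile.
Variables (m : nat) (code : seq instr).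

(* The boolean is set after the first of the two machine steps of a push. *)
Notation st := ('I_(size code).+1 * bool)%type.

Definition goto (p : nat) : st := (inord p, false).

Definition on_tape (i : nat) (d : sym * move) (r : {ffun 'I_m.+1 -> sym}) :
    {ffun 'I_m.+1 -> sym * move} :=
  [ffun j : 'I_m.+1 => if val j == i then d else (r j, Stay)].

(** A machine writes before it moves, so a push first moves left and writes in a second step. A jump
    names tape [m.+1], which does not exist, so every tape is kept. An address past the code
    halts. *)
Definition code_delta (q : st) (r : {ffun 'I_m.+1 -> sym}) :
    option (st * {ffun 'I_m.+1 -> sym * move}) :=
  if (size code <= q.1)%N then None else
  match nth (IJmp 0) code q.1 with
  | IPush i b =>
      if q.2 then Some (goto q.1.+1, on_tape i (Some b, Stay) r)
      else Some ((q.1, true), on_tape i (r (inord i), MoveLeft) r)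
  | IPop i pe p0 p1 =>
      match r (inord i) with
      | None => Some (goto pe, on_tape i (None, Stay) r)
      | Some false => Some (goto p0, on_tape i (None, MoveRight) r)
      | Some true => Some (goto p1, on_tape i (None, MoveRight) r)
      end
  | IJmp p => Some (goto p, on_tape m.+1 (None, Stay) r)
  end.

Definition code_tm : TM := @MakeTM m st (goto 0) code_delta.

(* A stack is a tape whose head scans the top; every popped cell is blank. *)
Definition tape_stack (a : tape) (w : bits) : Prop :=
  (exists n, a.1 = nseq n None) /\ (exists n, a.2 = map Some w ++ nseq n None).

Lemma tape_stack_word a w : tape_stack a w -> tape_word a = w.
Proof.
case: a => a1 a2 [_ [n /= ->]]; rewrite /tape_word /=.
by elim: w => /= [|b w ->] //; case: n.
Qed.

Lemma tape_stack_init w : tape_stack (tape_of_bits w) w.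
Proof. by split; exists 0; rewrite //= cats0. Qed.

Lemma tape_stack_read a w : tape_stack a w -> tape_read a = ohead w.
Proof.
by case: a => a1 a2 [_ [n /= ->]]; case: w => //=; case: n.
Qed.

(** Writing a blank back at the end of the list lengthens it by one cell; the padding by blanks in
    [tape_stack] absorbs this. *)
Lemma tape_stack_keep a w : tape_stack a w ->
  tape_stack (tape_move Stay (tape_write (tape_read a) a)) w.
Proof.
case: a => a1 a2 [[k /= ->] [n /= ->]]; split; first by exists k.
case: w => [|b w] /=; last by exists n.
by case: n => [|n]; [exists 1 | exists n.+1].
Qed.

Lemma tape_stack_push a w b : tape_stack a w ->
  tape_stack (tape_move Stay (tape_write (Some b)
    (tape_move MoveLeft (tape_write (tape_read a) a)))) (b :: w).
Proof.
move=> /tape_stack_keep; case: a => a1 a2 [[k /= ->] [n /= ->]].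
by split; [exists k.-1; case: k | exists n].
Qed.

Lemma tape_stack_pop a w b : tape_stack a (b :: w) ->
  tape_stack (tape_move MoveRight (tape_write None a)) w.
Proof.
case: a => a1 a2 [[k /= ->] [n /= ->]].
by split; [exists k.+1 | exists n].
Qed.

Definition tapes_stacks (a : {ffun 'I_m.+1 -> tape}) (s : stacks) : Prop :=
  forall j : 'I_m.+1, tape_stack (a j) (nth [::] s j).

Definition at_pc (p : nat) (s : stacks) (c : config code_tm) : Prop :=
  c.1 = goto p /\ tapes_stacks c.2 s.

Definition runs (p : nat) (s : stacks) (p' : nat) (s' : stacks) : Prop :=
  forall c, at_pc p s c -> exists2 c', tm_reach c c' & at_pc p' s' c'.

Lemma runs_refl p s : runs p s p s.
Proof. by move=> c H; exists c => //; exact: tm_reach_refl. Qed.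

Lemma runs_trans p s p' s' p'' s'' :
  runs p s p' s' -> runs p' s' p'' s'' -> runs p s p'' s''.
Proof.
move=> H1 H2 c /H1 [c1 R1 /H2 [c2 R2 A]].
by exists c2 => //; apply: tm_reach_trans R1 R2.
Qed.

Definition apply_tapes (act : {ffun 'I_m.+1 -> sym * move}) (a : {ffun 'I_m.+1 -> tape}) :
  {ffun 'I_m.+1 -> tape} := [ffun j => tape_move (act j).2 (tape_write (act j).1 (a j))].

Definition reads (a : {ffun 'I_m.+1 -> tape}) := [ffun j => tape_read (a j)].

Lemma step_at (c : config code_tm) p q act :
  p < size code -> c.1.1 = inord p ->
  code_delta c.1 (reads c.2) = Some (q, act) ->
  tm_step c = Some (q, apply_tapes act c.2).
Proof. by move=> lt_p e; rewrite /tm_step /= /reads => ->. Qed.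

Lemma runs_jmp p q s : p < size code -> nth (IJmp 0) code p = IJmp q -> runs p s q s.
Proof.
move=> lt_p Ep c [E1 E2]; pose act := on_tape m.+1 (None, Stay) (reads c.2).
have Sc : tm_step c = Some (goto q, apply_tapes act c.2).
  apply: (@step_at _ p) => //; first by rewrite E1.
  by rewrite /code_delta E1 /= inordK ?ltnS ?(ltnW lt_p) // leqNgt lt_p /= Ep.
exists ((goto q, apply_tapes act c.2) : config code_tm); first exact: tm_reach_step.
split=> // j; rewrite /= !ffunE.
have -> : (val j == m.+1) = false by apply: ltn_eqF; exact: ltn_ord.
exact: tape_stack_keep.
Qed.

Lemma runs_push p i b s : i <= m -> p < size code -> nth (IJmp 0) code p = IPush i b ->
  runs p s p.+1 (upd s i (b :: nth [::] s i)).
Proof.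
move=> le_i lt_p Ep [[q ph] a] [/= [E1 E2] E3].
pose act1 := on_tape i (reads a (inord i), MoveLeft) (reads a).
pose a1 := apply_tapes act1 a.
pose act2 := on_tape i (Some b, Stay) (reads a1).
have Eq : nat_of_ord q = p by rewrite E1 inordK // ltnS ltnW.
have Sc : tm_step (((q, ph), a) : config code_tm) = Some ((q, true), a1).
  apply: (@step_at _ p) => //.
  by rewrite /code_delta /= E2 Eq leqNgt lt_p /= Ep.
have Sc' : tm_step (((q, true), a1) : config code_tm) = Some (goto p.+1, apply_tapes act2 a1).
  apply: (@step_at _ p) => //.
  by rewrite /code_delta /= Eq leqNgt lt_p /= Ep.
exists ((goto p.+1, apply_tapes act2 a1) : config code_tm).
  apply: tm_reach_trans; first exact: tm_reach_step Sc.
  exact: tm_reach_step Sc'.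
split=> // j; rewrite /= nth_set_nth /= !ffunE; case: eqP => [Ej|_].
  have -> : inord i = j by apply: val_inj; rewrite /= inordK ?ltnS.
  by rewrite /= -Ej; apply: tape_stack_push.
by rewrite /=; do 2!apply: tape_stack_keep.
Qed.

Lemma runs_pop p i pe p0 p1 s : i <= m -> p < size code ->
  nth (IJmp 0) code p = IPop i pe p0 p1 ->
  match nth [::] s i with
  | [::] => runs p s pe s
  | b :: w => runs p s (if b then p1 else p0) (upd s i w)
  end.
Proof.
move=> le_i lt_p Ep.
have Ei (j : 'I_m.+1) : val j = i -> inord i = j.
  by move=> Ej; apply: val_inj; rewrite /= inordK ?ltnS.
have Ri (a : {ffun 'I_m.+1 -> tape}) : tapes_stacks a s ->
    reads a (inord i) = ohead (nth [::] s i).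
  move=> A; rewrite ffunE (tape_stack_read (A _)).
  by rewrite inordK ?ltnS.
case Es: (nth [::] s i) => [|b w] c [E1 E2].
  pose act := on_tape i (None, Stay) (reads c.2).
  have Sc : tm_step c = Some (goto pe, apply_tapes act c.2).
    apply: (@step_at _ p) => //; first by rewrite E1.
    rewrite /code_delta E1 /= inordK ?ltnS ?(ltnW lt_p) // leqNgt lt_p /= Ep.
    by rewrite (Ri _ E2) Es.
  exists ((goto pe, apply_tapes act c.2) : config code_tm); first exact: tm_reach_step.
  split=> // j; rewrite /= !ffunE; case: eqP => [Ej|_]; last exact: tape_stack_keep.
  have /= := tape_stack_keep (E2 j).
  by rewrite (tape_stack_read (E2 j)) Ej Es.
pose act := on_tape i (None, MoveRight) (reads c.2).
have Sc : tm_step c = Some (goto (if b then p1 else p0), apply_tapes act c.2).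
  apply: (@step_at _ p) => //; first by rewrite E1.
  rewrite /code_delta E1 /= inordK ?ltnS ?(ltnW lt_p) // leqNgt lt_p /= Ep.
  by rewrite (Ri _ E2) Es /=; case: (b).
exists ((goto (if b then p1 else p0), apply_tapes act c.2) : config code_tm);
  first exact: tm_reach_step.
split=> // j; rewrite /= nth_set_nth /= !ffunE; case: eqP => [Ej|_];
  last exact: tape_stack_keep.
by apply: (tape_stack_pop (b := b)); rewrite -Es -Ej.
Qed.

Fixpoint cmd_wf (c : cmd) : bool :=
  match c with
  | Skip => true
  | Push i _ => i <= m
  | Seq c1 c2 => cmd_wf c1 && cmd_wf c2
  | Case i ce c0 c1 => [&& i <= m, cmd_wf ce, cmd_wf c0 & cmd_wf c1]
  | Loop i c0 c1 => [&& i <= m, cmd_wf c0 & cmd_wf c1]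
  end.

(** Induction on the execution, not on the command: the last premise of a loop step is the same loop
    again, placed at the same address [p], to which the jump after the body returns. *)
Lemma exec_runs c s s' p : exec c s s' -> cmd_wf c ->
  code_at code p (compile p c) -> runs p s (p + clen c) s'.
Proof.
move=> ex; elim: ex p => {c s s'} /=.
- by move=> s p _ _; rewrite addn0; exact: runs_refl.
- move=> i b s p le_i /code_at_nth [lt_p Ep]; rewrite addn1; exact: runs_push.
- move=> c1 c2 s1 s2 s3 _ IH1 _ IH2 p /andP[w1 w2] H.
  apply: runs_trans (IH1 _ w1 (code_at_catl H)) _.
  rewrite addnA; apply: IH2 => //.
  by have := code_at_catr H; rewrite size_compile.
- move=> i ce c0 c1 s s' Es _ IH p /and4P[le_i we w0 w1] H.
  have [lt_p Ep] := code_at_nth H.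
  have := runs_pop s le_i lt_p Ep; rewrite Es => /runs_trans; apply.
  have H1 := code_at_tail H.
  apply: runs_trans (IH _ we (code_at_catl H1)) _.
  have := code_at_catr H1; rewrite size_compile => /code_at_nth [lt_q Eq].
  have := @runs_jmp _ _ s' lt_q Eq; congr runs; lia.
- move=> i ce c0 c1 s s' b w Es _ IH p /and4P[le_i we w0 w1] H.
  have [lt_p Ep] := code_at_nth H.
  have := runs_pop s le_i lt_p Ep; rewrite Es => /runs_trans; apply.
  have H1 := code_at_tail (code_at_catr (code_at_tail H)).
  rewrite size_compile in H1.
  have e0 : (p.+1 + clen ce).+1 = p + (clen ce).+2 by lia.
  rewrite e0 in H1.
  case: b Es IH => Es IH.
    have H2 := code_at_tail (code_at_catr H1); rewrite size_compile in H2.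
    have e1 : (p + (clen ce).+2 + clen c0).+1 = p + (clen ce).+2 + (clen c0).+1 by lia.
    rewrite e1 in H2.
    have := IH _ w1 H2; congr runs; lia.
  apply: runs_trans (IH _ w0 (code_at_catl H1)) _.
  have := code_at_catr H1; rewrite size_compile => /code_at_nth [lt_q Eq].
  have := @runs_jmp _ _ s' lt_q Eq; congr runs; lia.
- move=> i c0 c1 s Es p /and3P[le_i w0 w1] H.
  have [lt_p Ep] := code_at_nth H.
  have := runs_pop s le_i lt_p Ep; rewrite Es; congr runs; lia.
- move=> i c0 c1 s s' s'' b w Es _ IH1 _ IH2 p W H.
  have /and3P[le_i w0 w1] := W.
  have [lt_p Ep] := code_at_nth H.
  have := runs_pop s le_i lt_p Ep; rewrite Es => /runs_trans; apply.
  apply: (@runs_trans _ _ p s'); last exact: IH2.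
  have H1 := code_at_tail H.
  case: b Es IH1 => Es IH1.
    have H2 := code_at_tail (code_at_catr H1); rewrite size_compile in H2.
    have e1 : (p.+1 + clen c0).+1 = p + (clen c0).+2 by lia.
    rewrite e1 in H2.
    apply: runs_trans (IH1 _ w1 (code_at_catl H2)) _.
    have := code_at_catr H2; rewrite size_compile => /code_at_nth [lt_q Eq].
    exact: runs_jmp.
  apply: runs_trans (IH1 _ w0 (code_at_catl H1)) _.
  have := code_at_catr H1; rewrite size_compile => /code_at_nth [lt_q Eq].
  exact: runs_jmp.
Qed.

End Compile.

Definition cmd_tm m (c : cmd) : TM := code_tm m (compile 0 c).

Lemma exec_tm m (c : cmd) (ws s : stacks) : cmd_wf m c ->
  exec c ws s -> tm_eval (cmd_tm m c) ws (nth [::] s 0).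
Proof.
move=> wf ex.
have H : code_at (compile 0 c) 0 (compile 0 c) by exists [::], [::]; rewrite cats0.
have init_at : @at_pc m (compile 0 c) 0 ws (tm_init (cmd_tm m c) ws).
  by split=> // j; rewrite /= ffunE; exact: tape_stack_init.
have [c' R [E1 E2]] := exec_runs ex wf H init_at.
have Sc : tm_step c' = None.
  rewrite /tm_step /= /code_delta E1 /= inordK; last by rewrite ltnS size_compile.
  by have -> : size (compile 0 c) <= 0 + clen c by rewrite size_compile.
have [k Hk] := tm_reach_halt R Sc.
by exists k; rewrite Hk /tm_output (tape_stack_word (E2 ord0)).
Qed.

(** * Functions on encoded data *)

Inductive tree := Lf | Nd of tree & tree.

(* Preorder code. It is prefix-free, so one stack holds a stack of trees. *)
Fixpoint tcode (t : tree) : bits :=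
  if t is Nd a b then true :: tcode a ++ tcode b else [:: false].

Definition tcodes (ts : seq tree) : bits := flatten (map tcode ts).

Lemma tcode_inj_cat t t' r r' : tcode t ++ r = tcode t' ++ r' -> t = t' /\ r = r'.
Proof.
elim: t t' r r' => [|a IHa b IHb] [|a' b'] r r' //=; first by case.
by case; rewrite -!catA => /IHa [-> /IHb [-> ->]].
Qed.

Lemma tcode_inj : injective tcode.
Proof.
by move=> t t' e; have [] := @tcode_inj_cat t t' [::] [::]; rewrite ?cats0.
Qed.

(* Stack 2 holds the trees, stacks 3 and 4 are buffers and stack 5 a counter;
   the arguments arrive on stacks 0 and 1, and the result leaves on stack 0. *)
Definition tstate (a : bits) : stacks := [:: [::]; [::]; a; [::]; [::]; [::]].

(** Quantifying over the remainder [r] builds the frame rule in: a command proved correct on a few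
    trees works on top of any stack. *)
Definition trel (c : cmd) (ts ts' : seq tree) : Prop :=
  forall r, exec c (tstate (tcodes ts ++ r)) (tstate (tcodes ts' ++ r)).

Lemma trel_seq c1 c2 ts1 ts2 ts3 :
  trel c1 ts1 ts2 -> trel c2 ts2 ts3 -> trel (Seq c1 c2) ts1 ts3.
Proof. by move=> H1 H2 r; apply: ExSeq (H1 r) (H2 r). Qed.

Lemma trel_frame c ts ts' us : trel c ts ts' -> trel c (ts ++ us) (ts' ++ us).
Proof. by move=> H r; rewrite /tcodes !map_cat !flatten_cat -!catA; apply: H. Qed.

(** Stack 5 counts, in unary, the subtrees still to be read: a leaf settles one, a node replaces one
    by two. The preorder code of a tree thus ends exactly when the counter is empty. *)
Definition MvTree x :=
  Seq (Push 5 true)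
      (Loop 5 Skip
         (Case 2 Skip (Push x false) (Seq (Push x true) (Seq (Push 5 true) (Push 5 true))))).

Definition Mv x y := Loop x (Push y false) (Push y true).

Lemma exec_push_eq i b s s' : s' = upd s i (b :: nth [::] s i) -> exec (Push i b) s s'.
Proof. by move->; exact: ExPush. Qed.

Ltac ex_step :=
  simpl; match goal with
  | |- exec Skip _ _ => exact: ExSkip
  | |- exec (Push _ _) _ _ => exact: exec_push_eq
  | |- exec (Seq _ _) _ _ => eapply ExSeq
  | |- exec (Case _ _ _ _) _ _ =>
      first [ eapply ExCaseB; [reflexivity|] | eapply ExCaseE; [reflexivity|] ]
  end.

Definition buf (z : bool) (p u a w o d : bits) : stacks :=
  if z then [:: p; u; a; o; w; d] else [:: p; u; a; w; o; d].

Lemma exec_MvTree (z : bool) p u t a w o :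
  exec (MvTree (if z then 4 else 3))
    (buf z p u (tcode t ++ a) w o [::]) (buf z p u a (rev (tcode t) ++ w) o [::]).
Proof.
set x := if z then 4 else 3.
set body := Case 2 Skip (Push x false) (Seq (Push x true) (Seq (Push 5 true) (Push 5 true))).
(* Continuation form: the rest of the loop is a hypothesis, so the two children of a node are
   handled by chaining the two induction hypotheses. *)
have H n s' b v : exec (Loop 5 Skip body) (buf z p u b (rev (tcode t) ++ v) o (nseq n true)) s' ->
    exec (Loop 5 Skip body) (buf z p u (tcode t ++ b) v o (nseq n.+1 true)) s'.
  elim: t n b v => [|t1 IH1 t2 IH2] n b v H.
    apply: (@ExLoopB _ _ _ _ _ _ true (nseq n true)) (H); first by rewrite /buf; case: (z).
    by rewrite /body /x /buf; case: (z); ex_step; ex_step.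
  apply: (@ExLoopB _ _ _ _ _ _ true (nseq n true)); first by rewrite /buf; case: (z).
    have -> : upd (buf z p u (tcode (Nd t1 t2) ++ b) v o (nseq n.+1 true)) 5 (nseq n true) =
      buf z p u (true :: (tcode t1 ++ (tcode t2 ++ b))) v o (nseq n true).
      by rewrite /buf; case: (z); rewrite /= -catA.
    instantiate (1 := buf z p u (tcode t1 ++ (tcode t2 ++ b)) (true :: v) o (nseq n.+2 true)).
    by rewrite /body /x /buf; case: (z); ex_step; ex_step; [ex_step|ex_step; ex_step|ex_step|ex_step; ex_step].
  apply: IH1; apply: IH2.
  by move: H; rewrite /= rev_cons rev_cat cat_rcons catA.
apply: (@ExSeq _ _ _ (buf z p u (tcode t ++ a) w o [:: true])).
  by rewrite /buf; case: (z); ex_step.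
apply: (H 0); apply: ExLoopE; by rewrite /buf; case: (z).
Qed.

Lemma size_upd s i w : i < size s -> size (upd s i w) = size s.
Proof. by move=> lt_i; rewrite size_set_nth; apply/maxn_idPr. Qed.

Lemma exec_Mv x y s s' : x != y -> x < size s -> y < size s ->
  s' = upd (upd s x [::]) y (rev (nth [::] s x) ++ nth [::] s y) -> exec (Mv x y) s s'.
Proof.
move=> xy; move Ew: (nth [::] s x) => w; elim: w s s' Ew => [|b w IH] s s' Ew lt_x lt_y ->.
  have -> : upd (upd s x [::]) y (rev [::] ++ nth [::] s y) = s.
    apply: (@eq_from_nth _ [::]) => [|j _]; first by rewrite !size_upd ?size_upd.
    by rewrite !nth_set_nth /=; case: (j =P y) => [-> //|_]; rewrite nth_set_nth /=; case: (j =P x) => [->|_].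
  exact: ExLoopE.
apply: (@ExLoopB _ _ _ _ _ _ b w) => //.
  by instantiate (1 := upd (upd s x w) y (b :: nth [::] (upd s x w) y)); case: b {Ew}; exact: ExPush.
have yx : (y == x) = false by rewrite eq_sym (negbTE xy).
apply: IH; rewrite ?size_upd //.
  by rewrite !nth_set_nth /= (negbTE xy) nth_set_nth /= eqxx.
apply: (@eq_from_nth _ [::]) => [|j _]; first by rewrite !size_upd ?size_upd.
rewrite !nth_set_nth /= !nth_set_nth /= eqxx yx rev_cons cat_rcons.
by rewrite !nth_set_nth /= !nth_set_nth /=; case: (j == y); case: (j == x).
Qed.

Definition TSwap := Seq (MvTree 3) (Seq (MvTree 4) (Seq (Mv 3 2) (Mv 4 2))).

Lemma trel_swap x y : trel TSwap [:: x; y] [:: y; x].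
Proof.
move=> r; rewrite /tcodes /= !cats0 -!catA.
apply: ExSeq; first exact: (exec_MvTree false).
apply: ExSeq; first exact: (exec_MvTree true).
apply: ExSeq; first exact: exec_Mv.
by apply: exec_Mv; rewrite //= !cats0 !revK.
Qed.

Definition TDrop := Seq (MvTree 3) (Loop 3 Skip Skip).

Lemma trel_drop x : trel TDrop [:: x] [::].
Proof.
move=> r; rewrite /tcodes /= !cats0.
apply: ExSeq; first exact: (exec_MvTree false).
rewrite /= cats0; elim: (rev _) => [|b w IH]; first exact: ExLoopE.
apply: (@ExLoopB _ _ _ _ _ _ b w) IH => //.
by case: b; exact: ExSkip.
Qed.

Definition TDup :=
  Seq (MvTree 3)
      (Seq (Loop 3 (Seq (Push 2 false) (Push 4 false)) (Seq (Push 2 true) (Push 4 true)))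
           (Seq (Mv 4 3) (Mv 3 2))).

Lemma trel_dup x : trel TDup [:: x] [:: x; x].
Proof.
move=> r; rewrite /tcodes /= !cats0.
apply: ExSeq; first exact: (exec_MvTree false).
have H w a c : exec (Loop 3 (Seq (Push 2 false) (Push 4 false)) (Seq (Push 2 true) (Push 4 true)))
    [:: [::]; [::]; a; w; c; [::]] [:: [::]; [::]; rev w ++ a; [::]; rev w ++ c; [::]].
  elim: w a c => [|b w IH] a c; first exact: ExLoopE.
  apply: (@ExLoopB _ _ _ _ _ _ b w) => //; last first.
    by rewrite !rev_cons !cat_rcons; exact: IH.
  by case: b; ex_step; ex_step.
apply: ExSeq; first exact: H.
apply: ExSeq; first exact: exec_Mv.
by apply: exec_Mv; rewrite //= !cats0 !revK -!catA.
Qed.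

Definition TCons := Push 2 true.

Lemma trel_cons x y : trel TCons [:: x; y] [:: Nd x y].
Proof. by move=> r; rewrite /tcodes /= !cats0 -?catA; exact: exec_push_eq. Qed.

Definition enc_bool (b : bool) : tree := if b then Nd Lf Lf else Lf.

Definition TBad := Case 2 Skip (Push 2 false) (Push 2 false).

(** A flag lies on top of stack 2 while the two reversed codes are popped in parallel; [TBad] lowers
    it at each mismatch and at each bit left over in the longer code. The last command turns the
    flag into the code of a boolean. *)
Definition TEq :=
  Seq (MvTree 3) (Seq (MvTree 4) (Seq (Push 2 true)
   (Seq (Seq (Loop 3 (Case 4 TBad Skip TBad) (Case 4 TBad TBad Skip)) (Loop 4 TBad TBad))
   (Case 2 Skip (Push 2 false) (Seq (Push 2 false) (Seq (Push 2 false) (Push 2 true))))))).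

Lemma exec_TBad (fl : bool) p u a b c d :
  exec TBad [:: p; u; fl :: a; b; c; d] [:: p; u; false :: a; b; c; d].
Proof. by rewrite /TBad; ex_step; case: fl; ex_step. Qed.

Lemma trel_eq x y : trel TEq [:: x; y] [:: enc_bool `[< x = y >]].
Proof.
move=> r; rewrite /tcodes /= !cats0 -!catA.
apply: ExSeq; first exact: (exec_MvTree false).
apply: ExSeq; first exact: (exec_MvTree true).
apply: ExSeq; first exact: exec_push_eq.
rewrite /= !cats0.
have H2 c fl a : exec (Loop 4 TBad TBad) [:: [::]; [::]; fl :: a; [::]; c; [::]]
   [:: [::]; [::]; (fl && (c == [::])) :: a; [::]; [::]; [::]].
  elim: c fl => [|b c IH] fl; first by rewrite andbT; exact: ExLoopE.
  apply: (@ExLoopB _ _ _ _ _ _ b c) => //; last first.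
    by rewrite andbF; exact: (IH false).
  by case: b; exact: exec_TBad.
have H1 b c fl a : exec (Seq (Loop 3 (Case 4 TBad Skip TBad) (Case 4 TBad TBad Skip)) (Loop 4 TBad TBad))
   [:: [::]; [::]; fl :: a; b; c; [::]] [:: [::]; [::]; (fl && (b == c)) :: a; [::]; [::]; [::]].
  elim: b c fl => [|x1 b IH] c fl.
    by apply: ExSeq; [exact: ExLoopE | rewrite eq_sym; exact: H2].
  case: c => [|x2 c].
    (* Inversion separates the run of the first loop from that of the second, so that one more
       iteration can be put in front of the first. *)
    have := IH [::] false; rewrite andbF /= => E; inversion E; subst.
    apply: ExSeq; last by eassumption.
    apply: (@ExLoopB _ _ _ _ _ _ x1 b) => //; last by eassumption.
    by case: (x1); ex_step; exact: exec_TBad.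
  have := IH c (fl && (x1 == x2)) => E; inversion E; subst.
  rewrite eqseq_cons andbA.
  apply: ExSeq; last by eassumption.
  apply: (@ExLoopB _ _ _ _ _ _ x1 b) => //; last by eassumption.
  by case: (x1); case: (x2); rewrite ?andbT ?andbF; ex_step; (exact: ExSkip || exact: exec_TBad).
apply: ExSeq; first exact: H1.
rewrite (inj_eq (can_inj revK)) /=.
have -> : (tcode x == tcode y) = `[< x = y >].
  apply/eqP/asboolP => [/tcode_inj //|-> //].
case: asboolP => _ /=; ex_step; last exact: exec_push_eq.
by ex_step; [ex_step|ex_step; ex_step].
Qed.

(** * Computability of functions between encoded types *)

(** Injectivity lets [cpt_eq] decide equality on codes. The codes of [false], [0], [[::]] and [None]
    are all the leaf, so popping one bit decides every case analysis. *)
Class Enc (X : Type) := { enc : X -> tree; enc_injective : injective enc }.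

Fixpoint enc_nat (n : nat) : tree := if n is n'.+1 then Nd Lf (enc_nat n') else Lf.

Fixpoint enc_seq X (e : X -> tree) (s : seq X) : tree :=
  if s is x :: s' then Nd (e x) (enc_seq e s') else Lf.

Definition enc_option X (e : X -> tree) (o : option X) : tree :=
  if o is Some x then Nd Lf (e x) else Lf.

Definition enc_pair X Y (e : X -> tree) (e' : Y -> tree) (z : X * Y) : tree :=
  Nd (e z.1) (e' z.2).

Lemma enc_bool_inj : injective enc_bool.
Proof. by case=> [] []. Qed.

Lemma enc_nat_inj : injective enc_nat.
Proof. by elim=> [|n IH] [|m] //= [] /IH ->. Qed.

Lemma enc_seq_inj X (e : X -> tree) : injective e -> injective (enc_seq e).
Proof. by move=> inj; elim=> [|x s IH] [|y t] //= [] /inj -> /IH ->. Qed.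

Lemma enc_option_inj X (e : X -> tree) : injective e -> injective (enc_option e).
Proof. by move=> inj [x|] [y|] //= [] /inj ->. Qed.

Lemma enc_pair_inj X Y (e : X -> tree) (e' : Y -> tree) :
  injective e -> injective e' -> injective (enc_pair e e').
Proof. by move=> i i' [x y] [x' y'] /= [] /i -> /i' ->. Qed.

#[export] Instance Enc_bool : Enc bool := {| enc_injective := enc_bool_inj |}.
#[export] Instance Enc_nat : Enc nat := {| enc_injective := enc_nat_inj |}.
#[export] Instance Enc_seq X (E : Enc X) : Enc (seq X) :=
  {| enc_injective := enc_seq_inj (@enc_injective X E) |}.
#[export] Instance Enc_option X (E : Enc X) : Enc (option X) :=
  {| enc_injective := enc_option_inj (@enc_injective X E) |}.
#[export] Instance Enc_pair X Y (E : Enc X) (F : Enc Y) : Enc (X * Y) :=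
  {| enc_injective := enc_pair_inj (@enc_injective X E) (@enc_injective Y F) |}.

Definition cpt_by {X Y} `{Enc X} `{Enc Y} (c : cmd) (F : X -> Y) : Prop :=
  cmd_wf 5 c /\ forall x, trel c [:: enc x] [:: enc (F x)].

Definition cpt {X Y} `{Enc X} `{Enc Y} (F : X -> Y) : Prop := exists c, cpt_by c F.

Section Basic.
Context {X Y Z : Type} `{EX : Enc X} `{EY : Enc Y} `{EZ : Enc Z}.

Lemma eq_cpt (F G : X -> Y) : F =1 G -> cpt F -> cpt G.
Proof. by move=> e [c [w H]]; exists c; split=> // x; rewrite -e. Qed.

Lemma cpt_id : cpt (fun x : X => x).
Proof. by exists Skip; split=> // x r; exact: ExSkip. Qed.

Fixpoint TPush (t : tree) : cmd :=
  if t is Nd a b then Seq (TPush b) (Seq (TPush a) TCons) else Push 2 false.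

Lemma TPush_wf t : cmd_wf 5 (TPush t).
Proof. by elim: t => //= a -> b ->. Qed.

Lemma trel_push t : trel (TPush t) [::] [:: t].
Proof.
elim: t => [|a IHa b IHb] /=; first by move=> r; exact: exec_push_eq.
apply: trel_seq IHb _; apply: trel_seq (trel_cons a b).
exact: (trel_frame [:: b] IHa).
Qed.

Lemma cpt_const (y : Y) : cpt (fun _ : X => y).
Proof.
exists (Seq TDrop (TPush (enc y))); split; first by rewrite /= TPush_wf.
by move=> x; apply: trel_seq (trel_drop _) (trel_push _).
Qed.

Lemma cpt_comp (F : X -> Y) (G : Y -> Z) : cpt F -> cpt G -> cpt (fun x => G (F x)).
Proof.
move=> [c [w H]] [c' [w' H']]; exists (Seq c c'); split; first by rewrite /= w w'.
by move=> x; apply: trel_seq (H x) (H' _).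
Qed.

Lemma cpt_pair (F : X -> Y) (G : X -> Z) : cpt F -> cpt G -> cpt (fun x => (F x, G x)).
Proof.
move=> [c [w H]] [c' [w' H']].
exists (Seq TDup (Seq c (Seq TSwap (Seq c' (Seq TSwap TCons))))).
split; first by rewrite /= w w'.
move=> x; apply: trel_seq (trel_dup _) _.
apply: trel_seq (trel_frame [:: enc x] (H x)) _.
apply: trel_seq (trel_swap _ _) _.
apply: trel_seq (trel_frame [:: enc (F x)] (H' x)) _.
apply: trel_seq (trel_swap _ _) _.
exact: trel_cons.
Qed.

End Basic.

Definition TUncons := Case 2 Skip Skip Skip.

Lemma trel_uncons a b : trel TUncons [:: Nd a b] [:: a; b].
Proof.
move=> r; rewrite /tcodes /= !cats0 -?catA; apply: ExCaseB; first by [].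
exact: ExSkip.
Qed.

Lemma trel_case_leaf c0 c1 ts ts' :
  trel c0 ts ts' -> trel (Case 2 Skip c0 c1) (Lf :: ts) ts'.
Proof. by move=> H r; apply: ExCaseB; [by [] | exact: H]. Qed.

Lemma trel_case_node c0 c1 a b ts ts' :
  trel c1 [:: a, b & ts] ts' -> trel (Case 2 Skip c0 c1) (Nd a b :: ts) ts'.
Proof.
move=> H r; move: (H r); rewrite /tcodes /= -!catA => H'.
by apply: ExCaseB; [by [] | exact: H'].
Qed.

Section Branching.
Context {X Y Z : Type} `{EX : Enc X} `{EY : Enc Y} `{EZ : Enc Z}.

Lemma cpt_fst (F : X -> Y * Z) : cpt F -> cpt (fun x => (F x).1).
Proof.
move=> HF; apply: (cpt_comp (G := @fst Y Z) HF).
exists (Seq TUncons (Seq TSwap TDrop)); split=> // -[x y].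
apply: trel_seq (trel_uncons _ _) _; apply: trel_seq (trel_swap _ _) _.
exact: (trel_frame [:: _] (trel_drop _)).
Qed.

Lemma cpt_snd (F : X -> Y * Z) : cpt F -> cpt (fun x => (F x).2).
Proof.
move=> HF; apply: (cpt_comp (G := @snd Y Z) HF).
exists (Seq TUncons TDrop); split=> // -[x y].
apply: trel_seq (trel_uncons _ _) _; exact: (trel_frame [:: _] (trel_drop _)).
Qed.

(* Branching on whether an encoding is a leaf; the children are dropped. *)
Lemma cpt_branch (B : X -> bool) (F G : X -> Y) :
  (exists c, cmd_wf 5 c /\ forall x, exists a b,
     trel c [:: enc x] [:: if B x then Nd a b else Lf]) ->
  cpt F -> cpt G -> cpt (fun x => if B x then F x else G x).
Proof.
move=> [cB [wB HB]] [c [w H]] [c' [w' H']].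
exists (Seq TDup (Seq cB (Case 2 Skip c' (Seq TDrop (Seq TDrop c))))).
split; first by rewrite /= wB w w'.
move=> x; have [a [b HBx]] := HB x.
apply: trel_seq (trel_dup _) _.
apply: trel_seq (trel_frame [:: enc x] HBx) _.
case: (B x); last exact: trel_case_leaf.
apply: trel_case_node; apply: trel_seq (trel_frame [:: b; enc x] (trel_drop a)) _.
exact: trel_seq (trel_frame [:: enc x] (trel_drop b)) (H x).
Qed.

Lemma cpt_if (B : X -> bool) (F G : X -> Y) :
  cpt B -> cpt F -> cpt G -> cpt (fun x => if B x then F x else G x).
Proof.
move=> [c [w H]]; apply: cpt_branch; exists c; split=> // x; exists Lf, Lf.
exact: H.
Qed.

(** The code of [Some y] is that of the pair [(0, y)], so the pairing program serves unchanged; the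
    same holds for [cpt_cons] and [cpt_S]. *)
Lemma cpt_Some (F : X -> Y) : cpt F -> cpt (fun x => Some (F x)).
Proof.
move=> /(cpt_pair (cpt_const 0)) [c [w H]]; exists c; split=> // x; exact: H.
Qed.

Lemma cpt_cons (F : X -> Y) (G : X -> seq Y) : cpt F -> cpt G -> cpt (fun x => F x :: G x).
Proof.
move=> HF HG; have [c [w H]] := cpt_pair HF HG.
by exists c; split=> // x; exact: H.
Qed.

Lemma cpt_S (F : X -> nat) : cpt F -> cpt (fun x => (F x).+1).
Proof.
move=> /(cpt_pair (cpt_const 0)) [c [w H]]; exists c; split=> // x; exact: H.
Qed.

Lemma cpt_seq_match (L : X -> seq Y) (G : X -> Z) (F : X * (Y * seq Y) -> Z) :
  cpt L -> cpt G -> cpt F ->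
  cpt (fun x => if L x is y :: s then F (x, (y, s)) else G x).
Proof.
move=> [c [w H]] [cG [wG HG]] [cF [wF HF]].
(* [x] -> [Lx; x] -> case: leaf [x]; node [y; s; x] -> [x; (y, s)] *)
exists (Seq TDup (Seq c (Case 2 Skip cG (Seq TCons (Seq TSwap (Seq TCons cF)))))).
split; first by rewrite /= w wG wF.
move=> x; apply: trel_seq (trel_dup _) _.
apply: trel_seq (trel_frame [:: enc x] (H x)) _.
case: (L x) => [|y s]; first exact: trel_case_leaf.
apply: trel_case_node.
apply: trel_seq (trel_frame [:: enc x] (trel_cons (enc y) (enc s))) _.
exact: trel_seq (trel_swap _ _) (trel_seq (trel_cons _ _) (HF (x, (y, s)))).
Qed.

Lemma cpt_option_match (L : X -> option Y) (G : X -> Z) (F : X * Y -> Z) :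
  cpt L -> cpt G -> cpt F ->
  cpt (fun x => if L x is Some y then F (x, y) else G x).
Proof.
move=> [c [w H]] [cG [wG HG]] [cF [wF HF]].
exists (Seq TDup (Seq c (Case 2 Skip cG (Seq TDrop (Seq TSwap (Seq TCons cF)))))).
split; first by rewrite /= w wG wF.
move=> x; apply: trel_seq (trel_dup _) _.
apply: trel_seq (trel_frame [:: enc x] (H x)) _.
case: (L x) => [y|]; last exact: trel_case_leaf.
apply: trel_case_node.
apply: trel_seq (trel_frame [:: enc y; enc x] (trel_drop Lf)) _.
exact: trel_seq (trel_swap _ _) (trel_seq (trel_cons _ _) (HF (x, y))).
Qed.

End Branching.

Lemma cpt_nat_match {X Z : Type} `{Enc X} `{Enc Z} (L : X -> nat) (G : X -> Z)
    (F : X * nat -> Z) :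
  cpt L -> cpt G -> cpt F -> cpt (fun x => if L x is n.+1 then F (x, n) else G x).
Proof.
move=> [c [w HL]] HG HF.
(* The codes of [n.+1] and [Some n] coincide, and so do those of [0] and [None]. *)
have HL' : cpt (fun x => if L x is n.+1 then Some n else None).
  exists c; split=> // x; have := HL x; rewrite /=; by case: (L x).
apply: eq_cpt (cpt_option_match HL' HG HF) => x; by case: (L x).
Qed.

(** One bit on stack 5 is the permission for another round. It is popped before the round starts, so
    the test and the body find stack 5 empty, as [tstate] demands. *)
Definition TWhile cB cG :=
  Seq (Push 5 true)
      (Loop 5 Skip (Seq TDup (Seq cB
         (Case 2 Skip Skip (Seq TDrop (Seq TDrop (Seq cG (Push 5 true)))))))).

Lemma trel_while {X : Type} `{Enc X} (B : X -> bool) (G : X -> X) cB cG :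
  cpt_by cB B -> cpt_by cG G ->
  forall n x, (forall m, m < n -> B (iter m G x)) -> ~~ B (iter n G x) ->
  trel (TWhile cB cG) [:: enc x] [:: enc (iter n G x)].
Proof.
move=> [_ HB] [_ HG] n x Hlt Hn r; apply: ExSeq; first exact: ExPush.
elim: n x Hlt Hn => [|n IH] x Hlt Hn.
  apply: (@ExLoopB _ _ _ _ _ _ true [::]) => //; last exact: ExLoopE.
  have : trel (Seq TDup (Seq cB (Case 2 Skip Skip (Seq TDrop (Seq TDrop (Seq cG (Push 5 true)))))))
    [:: enc x] [:: enc x]; last exact.
  apply: trel_seq (trel_dup _) _; apply: trel_seq (trel_frame [:: _] (HB x)) _.
  by move: Hn => /= /negbTE -> /=; apply: trel_case_leaf => r'; exact: ExSkip.
have Bx := Hlt 0 isT; rewrite /= in Bx.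
apply: (@ExLoopB _ _ _ _ _ _ true [::]) => //; last first.
  rewrite iterSr; apply: IH => [m lt_m|]; last by rewrite -iterSr.
  by rewrite -iterSr; apply: Hlt.
apply: ExSeq; first exact: trel_dup.
apply: ExSeq; first exact: (trel_frame [:: _] (HB x)).
rewrite Bx; apply: ExCaseB; first by [].
have T := trel_seq (trel_frame [:: Lf; enc x] (trel_drop Lf))
  (trel_seq (trel_frame [:: enc x] (trel_drop Lf)) (HG x)).
(* The loop body ends by refilling stack 5 and hence is no [trel]; the run of its other commands is
   taken apart so that this push can be appended. *)
move: (T r) => {T} T; inversion T as [| |? ? ? s2 ? T1 T2 | | | | ]; subst.
inversion T2 as [| |? ? ? s3 ? T3 T4 | | | | ]; subst.
apply: ExSeq T1 _; apply: ExSeq T3 _; apply: ExSeq T4 _.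
exact: exec_push_eq.
Qed.

(** A while loop whose state holds the parameter, the accumulator and the rest of the list. *)
Lemma cpt_foldl {X A B : Type} `{Enc X} `{Enc A} `{Enc B}
    (f : X -> A -> B -> A) (a0 : X -> A) (L : X -> seq B) :
  cpt (fun z : X * (A * B) => f z.1 z.2.1 z.2.2) -> cpt a0 -> cpt L ->
  cpt (fun x => foldl (f x) (a0 x) (L x)).
Proof.
move=> Hf Ha HL.
pose T := (X * (A * seq B))%type.
pose Bd (z : T) := if z.2.2 is b :: s then true else false.
pose G (z : T) : T := if z.2.2 is b :: s then (z.1, (f z.1 z.2.1 b, s)) else z.
have HB : cpt Bd.
  apply: (@cpt_seq_match _ B _ _ _ _ (fun z : T => z.2.2) (fun=> false) (fun=> true));
    [apply: cpt_snd; apply: cpt_snd; exact: cpt_id | exact: cpt_const | exact: cpt_const].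
have HG : cpt G.
  apply: (@cpt_seq_match _ B _ _ _ _ (fun z : T => z.2.2) id
    (fun w => (w.1.1, (f w.1.1 w.1.2.1 w.2.1, w.2.2)))).
  - by apply: cpt_snd; apply: cpt_snd; exact: cpt_id.
  - exact: cpt_id.
  - apply: cpt_pair; first by apply: cpt_fst; apply: cpt_fst; exact: cpt_id.
    apply: cpt_pair; last by apply: cpt_snd; apply: cpt_snd; exact: cpt_id.
    apply: (cpt_comp (F := fun w : T * (B * seq B) => (w.1.1, (w.1.2.1, w.2.1))) _ Hf).
    apply: cpt_pair; first by apply: cpt_fst; apply: cpt_fst; exact: cpt_id.
    apply: cpt_pair; last by apply: cpt_fst; apply: cpt_snd; exact: cpt_id.
    by apply: cpt_fst; apply: cpt_snd; apply: cpt_fst; exact: cpt_id.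
have [cB [wB HcB]] := HB; have [cG [wG HcG]] := HG.
have HW : cpt (fun z : T => (z.1, (foldl (f z.1) z.2.1 z.2.2, [::] : seq B))).
  exists (TWhile cB cG); split; first by rewrite /= wB wG.
  move=> [x [a s]].
  have it m a' s' : m <= size s' ->
      iter m G (x, (a', s')) = (x, (foldl (f x) a' (take m s'), drop m s')).
    elim: m a' s' => [|m IH] a' [|b s'] //=; rewrite ?take0 ?drop0 //.
    by move=> le_m; rewrite -iterS iterSr /= IH.
  have := trel_while (conj wB HcB) (conj wG HcG) (n := size s) (x := (x, (a, s))).
  rewrite it // take_size drop_size; apply=> // m lt_m.
  rewrite it ?(ltnW lt_m) // /Bd /=.
  by case E: (drop m s) => //; move: (size_drop m s); rewrite E /=; lia.
have Hin : cpt (fun x : X => (x, (a0 x, L x)) : T).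
  by apply: cpt_pair; [exact: cpt_id | apply: cpt_pair].
by have := cpt_fst (cpt_snd (cpt_comp Hin HW)).
Qed.

Ltac cpt_step :=
  cbv beta;
  lazymatch goal with
  | |- cpt (fun x => x) => exact: cpt_id
  | |- cpt fst => exact: (cpt_fst cpt_id)
  | |- cpt snd => exact: (cpt_snd cpt_id)
  | |- cpt (fun x => ((@?F x), (@?G x))) => apply: (@cpt_pair _ _ _ _ _ _ F G)
  | |- cpt (fun x => (@?F x).1) => apply: (@cpt_fst _ _ _ _ _ _ F)
  | |- cpt (fun x => (@?F x).2) => apply: (@cpt_snd _ _ _ _ _ _ F)
  | |- cpt (fun x => if _ then _ else _) => eapply cpt_if
  | |- cpt (fun x => Some (@?F x)) => apply: (@cpt_Some _ _ _ _ F)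
  | |- cpt (fun x => (@?F x) :: (@?G x)) => apply: (@cpt_cons _ _ _ _ F G)
  | |- cpt (fun x => (@?F x).+1) => apply: (@cpt_S _ _ F)
  | |- cpt (fun x => foldl (@?f x) (@?a x) (@?L x)) => apply: (@cpt_foldl _ _ _ _ _ _ f a L)
  end.

Ltac cpt_step_list := fail.
Ltac cpt_hyp :=
  match goal with
  | H : cpt ?G |- cpt (fun x => ?G (@?F x)) => apply: (@cpt_comp _ _ _ _ _ _ F G _ H)
  end.
Ltac cpt_solve := repeat first [assumption | simple apply cpt_const | cpt_step | progress cpt_step_list | cpt_hyp]; cbv beta.

(** * Closure under list operations *)

Section Folds.
Context {X A B : Type} `{EX : Enc X} `{EA : Enc A} `{EB : Enc B}.

Lemma cpt_rev (L : X -> seq A) : cpt L -> cpt (fun x => rev (L x)).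
Proof.
move=> HL; apply: (@eq_cpt _ _ _ _ (fun x => foldl (fun s a => a :: s) [::] (L x))).
  move=> x; rewrite -[RHS]cats0; move: [::].
  by elim: (L x) => //= a s IH acc; rewrite IH rev_cons cat_rcons.
cpt_solve.
Qed.

Lemma cpt_foldr (f : X -> A -> B -> B) (b0 : X -> B) (L : X -> seq A) :
  cpt (fun z : X * (A * B) => f z.1 z.2.1 z.2.2) -> cpt b0 -> cpt L ->
  cpt (fun x => foldr (f x) (b0 x) (L x)).
Proof.
move=> Hf Hb HL.
apply: (@eq_cpt _ _ _ _ (fun x => foldl (fun b a => f x a b) (b0 x) (rev (L x)))).
  by move=> x; rewrite foldl_rev.
cpt_solve; last exact: cpt_rev.
apply: (cpt_comp (F := fun z : X * (B * A) => (z.1, (z.2.2, z.2.1))) _ Hf); cpt_solve.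
Qed.

End Folds.

Ltac cpt_step_list ::=
  lazymatch goal with
  | |- cpt (fun x => rev (@?L x)) => apply: (@cpt_rev _ _ _ _ L)
  | |- cpt (fun x => foldr (@?f x) (@?a x) (@?L x)) => apply: (@cpt_foldr _ _ _ _ _ _ f a L)
  end.

Section Maps.
Context {X A B : Type} `{EX : Enc X} `{EA : Enc A} `{EB : Enc B}.

Lemma cpt_map (f : X -> A -> B) (L : X -> seq A) :
  cpt (fun z : X * A => f z.1 z.2) -> cpt L -> cpt (fun x => map (f x) (L x)).
Proof.
move=> Hf HL.
apply: (@eq_cpt _ _ _ _ (fun x => foldr (fun a s => f x a :: s) [::] (L x))) => //.
cpt_solve; apply: (cpt_comp (F := fun z : X * (A * seq B) => (z.1, z.2.1)) _ Hf); cpt_solve.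
Qed.

Lemma cpt_cat (L M : X -> seq A) : cpt L -> cpt M -> cpt (fun x => L x ++ M x).
Proof.
move=> HL HM.
apply: (@eq_cpt _ _ _ _ (fun x => foldr (fun a s => a :: s) (M x) (L x))); last by cpt_solve.
by move=> x; elim: (L x) => //= a s ->.
Qed.

Lemma cpt_negb (F : X -> bool) : cpt F -> cpt (fun x => ~~ F x).
Proof.
by move=> HF; apply: (@eq_cpt _ _ _ _ (fun x => if F x then false else true)); [|cpt_solve].
Qed.

Lemma cpt_and (F G : X -> bool) : cpt F -> cpt G -> cpt (fun x => F x && G x).
Proof.
by move=> HF HG; apply: (@eq_cpt _ _ _ _ (fun x => if F x then G x else false)); [|cpt_solve].
Qed.

Lemma cpt_or (F G : X -> bool) : cpt F -> cpt G -> cpt (fun x => F x || G x).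
Proof.
by move=> HF HG; apply: (@eq_cpt _ _ _ _ (fun x => if F x then true else G x)); [|cpt_solve].
Qed.

Lemma cpt_filter (p : X -> A -> bool) (L : X -> seq A) :
  cpt (fun z : X * A => p z.1 z.2) -> cpt L -> cpt (fun x => filter (p x) (L x)).
Proof.
move=> Hp HL.
apply: (@eq_cpt _ _ _ _ (fun x => foldr (fun a s => if p x a then a :: s else s) [::] (L x))) => //.
cpt_solve; apply: (cpt_comp (F := fun z : X * (A * seq A) => (z.1, z.2.1)) _ Hp); cpt_solve.
Qed.

Lemma cpt_size (L : X -> seq A) : cpt L -> cpt (fun x => size (L x)).
Proof.
move=> HL; apply: (@eq_cpt _ _ _ _ (fun x => foldr (fun=> S) 0 (L x))) => //.
by cpt_solve; apply: cpt_S; cpt_solve.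
Qed.

End Maps.

Section Predicates.
Context {X A : Type} `{EX : Enc X} `{EA : Enc A}.

Lemma cpt_has (p : X -> A -> bool) (L : X -> seq A) :
  cpt (fun z : X * A => p z.1 z.2) -> cpt L -> cpt (fun x => has (p x) (L x)).
Proof.
move=> Hp HL.
apply: (@eq_cpt _ _ _ _ (fun x => foldr (fun a s => p x a || s) false (L x))) => //.
cpt_solve; apply: cpt_or; last by cpt_solve.
apply: (cpt_comp (F := fun z : X * (A * bool) => (z.1, z.2.1)) _ Hp); cpt_solve.
Qed.

Lemma cpt_all (p : X -> A -> bool) (L : X -> seq A) :
  cpt (fun z : X * A => p z.1 z.2) -> cpt L -> cpt (fun x => all (p x) (L x)).
Proof.
move=> Hp HL.
apply: (@eq_cpt _ _ _ _ (fun x => foldr (fun a s => p x a && s) true (L x))) => //.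
cpt_solve; apply: cpt_and; last by cpt_solve.
apply: (cpt_comp (F := fun z : X * (A * bool) => (z.1, z.2.1)) _ Hp); cpt_solve.
Qed.

Lemma cpt_count (p : X -> A -> bool) (L : X -> seq A) :
  cpt (fun z : X * A => p z.1 z.2) -> cpt L -> cpt (fun x => count (p x) (L x)).
Proof.
move=> Hp HL; apply: (@eq_cpt _ _ _ _ (fun x => size (filter (p x) (L x)))).
  by move=> x; rewrite size_filter.
by apply: cpt_size; apply: cpt_filter.
Qed.

Lemma cpt_iter (n : X -> nat) (f : X -> A -> A) (a0 : X -> A) :
  cpt n -> cpt (fun z : X * A => f z.1 z.2) -> cpt a0 ->
  cpt (fun x => iter (n x) (f x) (a0 x)).
Proof.
move=> [c [w Hn]] Hf Ha.
(* Since [enc_bool false] is a leaf, a number has the same code as a list of that many [false]; a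
   bounded iteration is therefore a fold. *)
have Hs : cpt (fun x => nseq (n x) false).
  exists c; split=> // x; have := Hn x; rewrite /=.
  by have -> // : enc_nat (n x) = enc_seq enc_bool (nseq (n x) false);
     elim: (n x) => //= m ->.
apply: (@eq_cpt _ _ _ _ (fun x => foldl (fun a _ => f x a) (a0 x) (nseq (n x) false))).
  move=> x; move: (a0 x); elim: (n x) => //= m IH a.
  by rewrite -iterS iterSr IH.
cpt_solve.
apply: (cpt_comp (F := fun z : X * (A * bool) => (z.1, z.2.1)) _ Hf); cpt_solve.
Qed.

End Predicates.

Section Nth.
Context {X A : Type} `{EX : Enc X} `{EA : Enc A}.

Lemma cpt_nth (a0 : A) (L : X -> seq A) (n : X -> nat) :
  cpt L -> cpt n -> cpt (fun x => nth a0 (L x) (n x)).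
Proof.
move=> HL Hn.
apply: (@eq_cpt _ _ _ _ (fun x => if iter (n x) (fun s => if s is a :: s' then s' else s) (L x)
   is a :: _ then a else a0)).
  move=> x; have -> s m : iter m (fun s => if s is a :: s' then s' else s) s = drop m s.
    elim: m s => [|m IH] s; first by rewrite drop0.
    by rewrite iterSr IH; case: s => //= ; case: (m).
  by rewrite -[n x in RHS]addn0 -nth_drop; case: (drop _ _).
apply: (@cpt_seq_match _ A _ _ _ _ _ (fun=> a0) (fun z => z.2.1)); cpt_solve.
apply: cpt_iter; cpt_solve.
apply: (@cpt_seq_match _ A _ _ _ _ _ (fun z => z.2) (fun z => z.2.2)); cpt_solve.
Qed.

End Nth.

Lemma cpt_eq {X : Type} {T : eqType} `{Enc X} `{Enc T} (F G : X -> T) :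
  cpt F -> cpt G -> cpt (fun x => F x == G x).
Proof.
move=> HF HG.
have HE : cpt (fun z : T * T => z.1 == z.2).
  exists (Seq TUncons TEq); split=> // -[a b].
  apply: trel_seq (trel_uncons _ _) _ => /=.
  have -> : (a == b) = `[< enc a = enc b >]; last exact: trel_eq.
  by apply/eqP/asboolP => [-> //|e]; exact: (enc_injective e).
by apply: (cpt_comp (F := fun x => (F x, G x)) _ HE); cpt_solve.
Qed.

Ltac cpt_step_nat := fail.

Ltac cpt_step_list ::=
  lazymatch goal with
  | |- cpt (fun x => rev (@?L x)) => apply: (@cpt_rev _ _ _ _ L)
  | |- cpt (fun x => foldr (@?f x) (@?a x) (@?L x)) => apply: (@cpt_foldr _ _ _ _ _ _ f a L)
  | |- cpt (fun x => map (@?f x) (@?L x)) => apply: (@cpt_map _ _ _ _ _ _ f L)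
  | |- cpt (fun x => cat (@?f x) (@?L x)) => apply: (@cpt_cat _ _ _ _ f L)
  | |- cpt (fun x => ~~ (@?f x)) => apply: (@cpt_negb _ _ f)
  | |- cpt (fun x => (@?f x) && (@?g x)) => apply: (@cpt_and _ _ f g)
  | |- cpt (fun x => (@?f x) || (@?g x)) => apply: (@cpt_or _ _ f g)
  | |- cpt (fun x => filter (@?f x) (@?L x)) => apply: (@cpt_filter _ _ _ _ f L)
  | |- cpt (fun x => size (@?L x)) => apply: (@cpt_size _ _ _ _ L)
  | |- cpt (fun x => has (@?f x) (@?L x)) => apply: (@cpt_has _ _ _ _ f L)
  | |- cpt (fun x => all (@?f x) (@?L x)) => apply: (@cpt_all _ _ _ _ f L)
  | |- cpt (fun x => count (@?f x) (@?L x)) => apply: (@cpt_count _ _ _ _ f L)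
  | |- cpt (fun x => iter (@?n x) (@?f x) (@?a x)) => apply: (@cpt_iter _ _ _ _ n f a)
  | |- cpt (fun x => nth ?a (@?L x) (@?n x)) => apply: (@cpt_nth _ _ _ _ a L n)
  | |- cpt (fun x => (@?f x) == (@?g x)) => apply: (@cpt_eq _ _ _ _ f g)
  | _ => cpt_step_nat
  end.

(** * Closure under arithmetic and further list functions *)

Lemma cpt_addn {X : Type} `{EX : Enc X} (F G : X -> nat) :
  cpt F -> cpt G -> cpt (fun x => F x + G x).
Proof.
move=> HF HG; apply: (@eq_cpt _ _ _ _ (fun x => iter (F x) (fun n => n.+1) (G x))).
  by move=> x; rewrite iter_succn addnC.
cpt_solve.
Qed.

Lemma cpt_pred {X : Type} `{EX : Enc X} (F : X -> nat) :
  cpt F -> cpt (fun x => (F x).-1).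
Proof.
move=> HF; apply: (@eq_cpt _ _ _ _ (fun x => if F x is n.+1 then n else 0)).
  by move=> x; case: (F x).
apply: (@cpt_nat_match _ _ _ _ F (fun=> 0) (fun z => z.2)); cpt_solve.
Qed.

Lemma cpt_subn {X : Type} `{EX : Enc X} (F G : X -> nat) :
  cpt F -> cpt G -> cpt (fun x => F x - G x).
Proof.
move=> HF HG; apply: (@eq_cpt _ _ _ _ (fun x => iter (G x) (fun n => n.-1) (F x))).
  by move=> x; rewrite iter_predn.
cpt_solve; apply: cpt_pred; cpt_solve.
Qed.

Lemma cpt_leq {X : Type} `{EX : Enc X} (F G : X -> nat) :
  cpt F -> cpt G -> cpt (fun x => F x <= G x).
Proof. by move=> HF HG; rewrite /leq; cpt_solve; apply: cpt_subn. Qed.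

Lemma cpt_muln {X : Type} `{EX : Enc X} (F G : X -> nat) :
  cpt F -> cpt G -> cpt (fun x => F x * G x).
Proof.
move=> HF HG; apply: (@eq_cpt _ _ _ _ (fun x => iter (F x) (fun n => G x + n) 0)).
  by move=> x; rewrite iter_addn_0 mulnC.
cpt_solve; apply: cpt_addn; cpt_solve.
Qed.

Lemma cpt_expn {X : Type} `{EX : Enc X} (F G : X -> nat) :
  cpt F -> cpt G -> cpt (fun x => F x ^ G x).
Proof.
move=> HF HG; apply: (@eq_cpt _ _ _ _ (fun x => iter (G x) (fun n => F x * n) 1)).
  by move=> x; rewrite iter_muln_1.
cpt_solve; apply: cpt_muln; cpt_solve.
Qed.

Ltac cpt_step_seq := fail.

Ltac cpt_step_nat ::=
  lazymatch goal with
  | |- cpt (fun x => addn (@?f x) (@?g x)) => apply: (@cpt_addn _ _ f g)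
  | |- cpt (fun x => subn (@?f x) (@?g x)) => apply: (@cpt_subn _ _ f g)
  | |- cpt (fun x => muln (@?f x) (@?g x)) => apply: (@cpt_muln _ _ f g)
  | |- cpt (fun x => expn (@?f x) (@?g x)) => apply: (@cpt_expn _ _ f g)
  | |- cpt (fun x => leq (@?f x) (@?g x)) => apply: (@cpt_leq _ _ f g)
  | |- cpt (fun x => predn (@?f x)) => apply: (@cpt_pred _ _ f)
  | _ => cpt_step_seq
  end.

Lemma cpt_rcons {X A : Type} `{EX : Enc X} `{EA : Enc A} (L : X -> seq A) (F : X -> A) :
  cpt L -> cpt F -> cpt (fun x => rcons (L x) (F x)).
Proof.
move=> HL HF; apply: (@eq_cpt _ _ _ _ (fun x => L x ++ [:: F x])).
  by move=> x; rewrite cats1.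
cpt_solve.
Qed.

Section SeqFunctions.
Context {X A : Type} `{EX : Enc X} `{EA : Enc A}.

Lemma cpt_flatten (L : X -> seq (seq A)) : cpt L -> cpt (fun x => flatten (L x)).
Proof. by move=> HL; rewrite /flatten; cpt_solve. Qed.

Lemma cpt_sumn (L : X -> seq nat) : cpt L -> cpt (fun x => sumn (L x)).
Proof. by move=> HL; rewrite /sumn; cpt_solve. Qed.

Lemma cpt_behead (L : X -> seq A) : cpt L -> cpt (fun x => behead (L x)).
Proof.
move=> HL; apply: (@eq_cpt _ _ _ _ (fun x => if L x is a :: s then s else [::])).
  by move=> x; case: (L x).
apply: (@cpt_seq_match _ A _ _ _ _ L (fun=> [::]) (fun z => z.2.2)); cpt_solve.
Qed.

Lemma cpt_head (a0 : A) (L : X -> seq A) : cpt L -> cpt (fun x => head a0 (L x)).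
Proof.
move=> HL; apply: (@eq_cpt _ _ _ _ (fun x => nth a0 (L x) 0)); last by cpt_solve.
by move=> x; rewrite nth0.
Qed.

Lemma cpt_iota (m n : X -> nat) : cpt m -> cpt n -> cpt (fun x => iota (m x) (n x)).
Proof.
move=> Hm Hn; apply: (@eq_cpt _ _ _ _ (fun x => foldl (fun s _ => rcons s (m x + size s)) [::] (iter (n x) (cons 0) [::]))).
  move=> x; have E j s : foldl (fun s _ => rcons s (m x + size s)) s (iter j (cons 0) [::]) =
     s ++ iota (m x + size s) j.
    elim: j s => [|j IHj] s /=; first by rewrite cats0.
    by rewrite IHj size_rcons cat_rcons addnS.
  by rewrite E /= addn0.
cpt_solve; by apply: cpt_rcons; cpt_solve.
Qed.

Lemma cpt_isSome (F : X -> option A) : cpt F -> cpt (fun x => isSome (F x)).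
Proof.
move=> HF.
by apply: (@cpt_option_match _ A _ _ _ _ F (fun=> false) (fun=> true)); cpt_solve.
Qed.

Lemma cpt_odflt (a0 : A) (F : X -> option A) : cpt F -> cpt (fun x => odflt a0 (F x)).
Proof.
move=> HF.
by apply: (@cpt_option_match _ A _ _ _ _ F (fun=> a0) (fun z => z.2)); cpt_solve.
Qed.

Lemma cpt_odd (F : X -> nat) : cpt F -> cpt (fun x => odd (F x)).
Proof.
move=> HF; apply: (@eq_cpt _ _ _ _ (fun x => iter (F x) negb false)); last by cpt_solve.
by move=> x; elim: (F x) => //= n ->.
Qed.

End SeqFunctions.

Section Membership.
Context {X : Type} {T : eqType} `{EX : Enc X} `{ET : Enc T}.

Lemma cpt_mem (F : X -> T) (L : X -> seq T) : cpt F -> cpt L -> cpt (fun x => F x \in L x).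
Proof.
move=> HF HL; apply: (@eq_cpt _ _ _ _ (fun x => has (fun a => a == F x) (L x))).
  by move=> x; rewrite -has_pred1; apply: eq_has => a.
cpt_solve.
Qed.

Lemma cpt_index (F : X -> T) (L : X -> seq T) : cpt F -> cpt L -> cpt (fun x => index (F x) (L x)).
Proof.
move=> HF HL; apply: (@eq_cpt _ _ _ _ (fun x => foldr (fun a n => if a == F x then 0 else n.+1) 0 (L x))).
  by move=> x; elim: (L x) => //= a s ->.
cpt_solve.
Qed.

End Membership.

Lemma cpt_undup {X : Type} {T : eqType} `{EX : Enc X} `{ET : Enc T} (L : X -> seq T) :
  cpt L -> cpt (fun x => undup (L x)).
Proof.
move=> HL; apply: (@eq_cpt _ _ _ _ (fun x => foldr (fun a s => if a \in s then s else a :: s) [::] (L x))).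
  by move=> x; elim: (L x) => //= a s ->; rewrite mem_undup.
cpt_solve; apply: cpt_mem; cpt_solve.
Qed.

Ltac cpt_step_code := fail.

Ltac cpt_step_seq ::=
  lazymatch goal with
  | |- cpt (fun x => rcons (@?f x) (@?g x)) => apply: (@cpt_rcons _ _ _ _ f g)
  | |- cpt (fun x => flatten (@?f x)) => apply: (@cpt_flatten _ _ _ _ f)
  | |- cpt (fun x => sumn (@?f x)) => apply: (@cpt_sumn _ _ f)
  | |- cpt (fun x => behead (@?f x)) => apply: (@cpt_behead _ _ _ _ f)
  | |- cpt (fun x => head ?a (@?f x)) => apply: (@cpt_head _ _ _ _ a f)
  | |- cpt (fun x => iota (@?f x) (@?g x)) => apply: (@cpt_iota _ _ f g)
  | |- cpt (fun x => isSome (@?f x)) => apply: (@cpt_isSome _ _ _ _ f)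
  | |- cpt (fun x => odflt ?a (@?f x)) => apply: (@cpt_odflt _ _ _ _ a f)
  | |- cpt (fun x => odd (@?f x)) => apply: (@cpt_odd _ _ f)
  | |- cpt (fun x => (@?f x) \in (@?g x)) => apply: (@cpt_mem _ _ _ _ f g)
  | |- cpt (fun x => index (@?f x) (@?g x)) => apply: (@cpt_index _ _ _ _ f g)
  | |- cpt (fun x => undup (@?f x)) => apply: (@cpt_undup _ _ _ _ f)
  | _ => cpt_step_code
  end.

(** * Division, logarithms, and the decoding of numbers and words *)

Lemma count_iota_lt m n : count (fun i => i < m) (iota 0 n) = minn m n.
Proof.
elim: n => [|n IH]; first by rewrite minn0.
rewrite -addn1 iotaD count_cat IH /= addn0 add0n; case: ltnP; lia.
Qed.

(** The greatest number with a downward closed property is found by counting the numbers below a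
    bound that have it; the logarithm is treated alike. *)
Lemma cpt_divn {X : Type} `{EX : Enc X} (F G : X -> nat) :
  cpt F -> cpt G -> cpt (fun x => F x %/ G x).
Proof.
move=> HF HG; apply: (@eq_cpt _ _ _ _ (fun x => if G x == 0 then 0 else
   count (fun i => i.+1 * G x <= F x) (iota 0 (F x)))); last by cpt_solve.
move=> x; case: eqP => [->|/eqP]; first by rewrite divn0.
rewrite -lt0n => G0; rewrite (eq_count (a2 := fun i => i < F x %/ G x)).
  by rewrite count_iota_lt; apply/minn_idPl; exact: leq_div.
by move=> i; rewrite leq_divRL.
Qed.

Lemma cpt_trunc_log2 {X : Type} `{EX : Enc X} (F : X -> nat) :
  cpt F -> cpt (fun x => trunc_log 2 (F x)).
Proof.
move=> HF; apply: (@eq_cpt _ _ _ _ (fun x => 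
   count (fun i => 2 ^ i.+1 <= F x) (iota 0 (F x)))); last by cpt_solve.
move=> x; have [->|] := posnP (F x); first by [].
move=> F0; rewrite (eq_count (a2 := fun i => i < trunc_log 2 (F x))).
  rewrite count_iota_lt; apply/minn_idPl.
  by apply: leq_trans (@trunc_logP 2 _ isT F0); apply: ltnW; exact: ltn_expl.
move=> i; apply/idP/idP => H; first exact: trunc_log_max.
by apply: leq_trans (@trunc_logP 2 _ isT F0); rewrite leq_exp2l.
Qed.

Lemma cpt_code_nat {X : Type} `{EX : Enc X} (F : X -> nat) :
  cpt F -> @cpt X (seq bool) _ _ (fun x => code_nat (F x)).
Proof.
move=> HF; rewrite /code_nat.
have H1 := cpt_trunc_log2 HF.
have H2 : cpt (fun z : X * nat => F z.1 %/ 2 ^ z.2) by apply: cpt_divn; cpt_solve.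
cpt_solve.
Qed.

Definition dec_nat (w : seq bool) : nat := foldr (fun (b : bool) n => b + 2 * n) 0 w.

Lemma cpt_dec_nat {X : Type} `{EX : Enc X} (F : X -> seq bool) :
  cpt F -> cpt (fun x => dec_nat (F x)).
Proof.
move=> HF; rewrite /dec_nat.
apply: (@eq_cpt _ _ _ _ (fun x => foldr (fun (b : bool) n => (if b then 1 else 0) + 2 * n) 0 (F x))).
  by move=> x; elim: (F x) => //= b s ->; case: b.
cpt_solve.
Qed.

Lemma code_natK : cancel code_nat dec_nat.
Proof.
move=> k; rewrite /code_nat.
have H m i : k %/ 2 ^ i < 2 ^ m ->
    dec_nat [seq odd (k %/ 2 ^ j) | j <- iota i m] = k %/ 2 ^ i.
  elim: m i => [|m IH] i /=; first by rewrite expn0; case: (k %/ 2 ^ i).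
  move=> lt_k; rewrite IH.
    by rewrite expnSr divnMA divn2 mul2n odd_double_half.
  by rewrite expnSr divnMA ltn_divLR // -expnSr.
by rewrite H ?divn1 // trunc_log_ltn.
Qed.

Lemma size_code_nat k : size (code_nat k) = (trunc_log 2 k).+1.
Proof. by rewrite size_map size_iota. Qed.

(** A three-state automaton: 0 expects a marker bit, 1 a data bit, and 2 copies everything after the
    end of the code word. *)
Definition split_step (st : nat * (seq bool * seq bool)) (b : bool) :=
  if st.1 == 0 then (if b then (1, st.2) else (2, st.2))
  else if st.1 == 1 then (0, (rcons st.2.1 b, st.2.2))
  else (2, (st.2.1, rcons st.2.2 b)).

Definition split_code (s : seq bool) : seq bool * seq bool :=
  (foldl split_step (0, ([::], [::])) s).2.

Lemma split_codeE w r : split_code (code_bits w ++ r) = (w, r).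
Proof.
rewrite /split_code foldl_cat /code_bits -cats1 foldl_cat.
have H1 v : foldl split_step (0, (v, [::])) (flatten [seq [:: true; b] | b <- w]) = (0, (v ++ w, [::])).
  elim: w v => [|b w IH] v /=; first by rewrite cats0.
  by rewrite /split_step /= -/split_step IH cat_rcons.
have H2 v : foldl split_step (2, (w, v)) r = (2, (w, v ++ r)).
  elim: r v => [|b r IH] v /=; first by rewrite cats0.
  by rewrite {2}/split_step /= IH cat_rcons.
by rewrite H1 /= /split_step /= -/split_step H2.
Qed.

Definition dec_step (st : seq (seq bool) * seq bool) :=
  if st.2 == [::] then st
  else (rcons st.1 (split_code st.2).1, (split_code st.2).2).

(** [size s] rounds suffice because every code word has at least one bit; surplus rounds change
    nothing. *)
Definition dec_seq (s : seq bool) : seq (seq bool) :=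
  (iter (size s) dec_step ([::], s)).1.

Lemma code_seqK : cancel code_seq dec_seq.
Proof.
move=> ws; rewrite /dec_seq.
have H n v : size ws <= n -> iter n dec_step (v, code_seq ws) = (v ++ ws, [::]).
  elim: ws n v => [|w ws IH] n v.
    by move=> _; rewrite cats0; elim: n => //= n ->.
  case: n => // n; rewrite ltnS => le_n; rewrite iterSr /dec_step /= -/dec_step.
  have -> : (code_seq (w :: ws) == [::]) = false.
    by apply/negbTE; rewrite -size_eq0 size_cat size_rcons.
  by rewrite split_codeE /= IH // cat_rcons.
rewrite H //; elim: ws {H} => //= w ws IH.
by rewrite size_cat size_rcons addSn ltnS (leq_trans IH) // leq_addl.
Qed.

Lemma cpt_split_code {X : Type} `{EX : Enc X} (F : X -> seq bool) : cpt F -> cpt (fun x => split_code (F x)).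
Proof. by move=> HF; rewrite /split_code /split_step; cpt_solve. Qed.

Lemma cpt_dec_seq {X : Type} `{EX : Enc X} (F : X -> seq bool) : cpt F -> cpt (fun x => dec_seq (F x)).
Proof.
move=> HF; rewrite /dec_seq /dec_step.
have Hs : cpt split_code by apply: cpt_split_code; cpt_solve.
by cpt_solve.
Qed.

Ltac cpt_step_rect := fail.

Ltac cpt_step_code ::=
  lazymatch goal with
  | |- cpt (fun x => divn (@?f x) (@?g x)) => apply: (@cpt_divn _ _ f g)
  | |- cpt (fun x => code_nat (@?f x)) => apply: (@cpt_code_nat _ _ f)
  | |- cpt (fun x => dec_nat (@?f x)) => apply: (@cpt_dec_nat _ _ f)
  | |- cpt (fun x => split_code (@?f x)) => apply: (@cpt_split_code _ _ f)
  | |- cpt (fun x => dec_seq (@?f x)) => apply: (@cpt_dec_seq _ _ f)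
  | _ => cpt_step_rect
  end.

(** * Simulation of Turing machines *)

Notation osym := (option bool).
Notation otape := (seq osym * seq osym)%type.

Section Simulation.
Variable M : TM.

Let n := (tm_tapes M).+1.
Notation sconf := (nat * seq otape)%type.
Notation dinput := (tm_state M * {ffun 'I_n -> sym})%type.

Definition tape_ids : seq nat := map val (enum 'I_n).

Definition move_code (m : move) : osym :=
  match m with MoveLeft => Some false | Stay => None | MoveRight => Some true end.

Definition sim_move (m : osym) (a : otape) : otape :=
  if m == None then a
  else if m == Some true then (head None a.2 :: a.1, behead a.2)
  else (behead a.1, head None a.1 :: a.2).

Lemma sim_moveE m a : sim_move (move_code m) a = tape_move m a.
Proof. by case: m. Qed.

Definition state_code (q : tm_state M) : nat := enum_rank q.

Definition delta_key (z : dinput) : nat * seq osym :=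
  (state_code z.1, [seq z.2 j | j <- enum 'I_n]).

Definition delta_val (z : dinput) : option (nat * seq (osym * osym)) :=
  if tm_delta z.1 z.2 is Some (q, act) then
    Some (state_code q, [seq ((act j).1, move_code (act j).2) | j <- enum 'I_n])
  else None.

(** For a fixed machine the transition function is a finite table, that is, a constant list, so
    looking it up is computable. *)
Definition delta_table (k : nat * seq osym) : option (nat * seq (osym * osym)) :=
  nth None (map delta_val (enum {: dinput})) (index k (map delta_key (enum {: dinput}))).

Lemma map_enum_ord_inj T (f g : {ffun 'I_n -> T}) :
  [seq f j | j <- enum 'I_n] = [seq g j | j <- enum 'I_n] -> f = g.
Proof. by move=> /eq_in_map e; apply/ffunP => j; apply: e; rewrite mem_enum. Qed.

Lemma delta_key_inj : injective delta_key.
Proof.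
move=> [q r] [q' r'] [] /ord_inj /enum_rank_inj -> /map_enum_ord_inj -> //.
Qed.

Lemma delta_tableE z : delta_table (delta_key z) = delta_val z.
Proof.
rewrite /delta_table index_map; last exact: delta_key_inj.
by rewrite (nth_map z) ?index_mem ?mem_enum // nth_index ?mem_enum.
Qed.

Definition sim_conf (c : config M) : sconf :=
  (state_code c.1, [seq c.2 j | j <- enum 'I_n]).

Definition sim_step (c : sconf) : option sconf :=
  if delta_table (c.1, [seq head None a.2 | a <- c.2]) is Some d then
    Some (d.1, [seq sim_move (nth (None, None) d.2 j).2
                 ((nth ([::], [::]) c.2 j).1,
                  (nth (None, None) d.2 j).1 :: behead (nth ([::], [::]) c.2 j).2)
               | j <- tape_ids])
  else None.

Lemma nth_map_enum T (x0 : T) (f : 'I_n -> T) (j : 'I_n) :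
  nth x0 [seq f j | j <- enum 'I_n] j = f j.
Proof. by rewrite (nth_map j) ?size_enum_ord // nth_ord_enum. Qed.

Lemma sim_stepE c : sim_step (sim_conf c) = omap sim_conf (tm_step c).
Proof.
rewrite /sim_step /tm_step /=.
have -> : (state_code c.1, [seq head None a.2 | a <- [seq c.2 j | j <- enum 'I_n]])
   = delta_key (c.1, [ffun j => tape_read (c.2 j)]).
  by congr pair; rewrite -map_comp; apply: eq_map => j; rewrite /= ffunE.
rewrite delta_tableE /delta_val /=.
case: (tm_delta _ _) => [[q act]|] //=; congr Some; congr pair.
rewrite /tape_ids -map_comp; apply: eq_map => j /=.
by rewrite ffunE !nth_map_enum -sim_moveE.
Qed.

Definition sim_output (c : sconf) : seq bool :=
  foldr (fun (s : osym) w => if s is Some b then b :: w else [::]) [::] (head ([::], [::]) c.2).2.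

Lemma sim_outputE c : sim_output (sim_conf c) = tm_output c.
Proof.
rewrite /sim_output /tm_output /tape_word -nth0 /=.
by rewrite (nth_map_enum _ _ ord0); elim: (c.2 ord0).2 => //= -[b|] s ->.
Qed.

(** A halted configuration is repeated instead of ending the run, so that the simulation is a plain
    bounded iteration, checked for halting afterwards. *)
Definition sim_run (k : nat) (c : sconf) : option (seq bool) :=
  let c' := iter k (fun c => odflt c (sim_step c)) c in
  if isSome (sim_step c') then None else Some (sim_output c').

Lemma sim_runE k c : sim_run k (sim_conf c) = tm_run k c.
Proof.
rewrite /sim_run; elim: k c => [|k IH] c.
  by rewrite /= sim_stepE sim_outputE; case: (tm_step c).
rewrite iterSr sim_stepE /=; case E: (tm_step c) => [c'|] /=; first exact: IH.
have -> : iter k (fun c => odflt c (sim_step c)) (sim_conf c) = sim_conf c.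
  by elim: k {IH} => //= k ->; rewrite sim_stepE E.
by rewrite sim_stepE E /= sim_outputE.
Qed.

Definition sim_init (ws : seq (seq bool)) : sconf :=
  (state_code (tm_start M), [seq ([::], map Some (nth [::] ws j)) | j <- tape_ids]).

Lemma sim_initE ws : sim_init ws = sim_conf (tm_init M ws).
Proof.
congr pair; rewrite /tape_ids -map_comp; apply: eq_map => j /=.
by rewrite ffunE.
Qed.

Lemma cpt_sim_step {X : Type} `{EX : Enc X} (F : X -> sconf) :
  cpt F -> cpt (fun x => sim_step (F x)).
Proof.
move=> HF; rewrite /sim_step /delta_table.
apply: (@cpt_option_match _ (nat * seq (osym * osym)) _ _ _ _ _ (fun=> None)
  (fun z => Some (z.2.1, [seq sim_move (nth (None, None) z.2.2 j).2
                 ((nth ([::], [::]) (F z.1).2 j).1,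
                  (nth (None, None) z.2.2 j).1 :: behead (nth ([::], [::]) (F z.1).2 j).2)
               | j <- tape_ids]))); rewrite /sim_move; cpt_solve.
Qed.

Lemma cpt_sim_output {X : Type} `{EX : Enc X} (F : X -> sconf) :
  cpt F -> cpt (fun x => sim_output (F x)).
Proof.
move=> HF; rewrite /sim_output; cpt_solve.
apply: (@cpt_option_match _ bool _ _ _ _ (fun z : X * (osym * seq bool) => z.2.1)
   (fun=> [::]) (fun z => z.2 :: z.1.2.2)); cpt_solve.
Qed.

Lemma cpt_tm_run {X : Type} `{EX : Enc X} (k : X -> nat) (ws : X -> seq (seq bool)) :
  cpt k -> cpt ws -> @cpt X (option (seq bool)) _ _ (fun x => tm_run (k x) (tm_init M (ws x))).
Proof.
move=> Hk Hws; apply: (@eq_cpt _ _ _ _ (fun x => sim_run (k x) (sim_init (ws x)))).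
  by move=> x; rewrite sim_initE sim_runE.
have H1 : cpt (fun x => sim_init (ws x)) by rewrite /sim_init; cpt_solve.
pose it x := iter (k x) (fun c => odflt c (sim_step c)) (sim_init (ws x)).
have H2 : cpt it.
  rewrite /it; cpt_solve.
  apply: (@cpt_option_match _ sconf _ _ _ _ (fun z : X * sconf => sim_step z.2) snd snd);
    cpt_solve; apply: cpt_sim_step; cpt_solve.
rewrite /sim_run -/(it _).
have H3 := cpt_sim_step H2; have H4 := cpt_sim_output H2.
cpt_solve.
Qed.

End Simulation.

(** * Enumerations bound Kolmogorov complexity *)

(** Turns an argument tape into the tree code of a list of bits. [Mv] reverses the word, so the list
    can be built from its last bit. *)
Definition TLoad x :=
  Seq (Mv x 3) (Seq (Push 2 false)
   (Loop 3 (Seq (Push 2 false) (Push 2 true))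
           (Seq (Push 2 false) (Seq (Push 2 false) (Seq (Push 2 true) (Push 2 true)))))).

(** Inverse of the loading: a leaf ends the list, a node whose left child is a leaf is the bit 0,
    and a node over a node is the bit 1. A bit on stack 5 keeps the loop alive. *)
Definition TStore :=
  Seq (Push 5 true) (Seq (Loop 5 Skip (Case 2 Skip Skip
    (Case 2 Skip (Seq (Push 3 false) (Push 5 true))
       (Case 2 Skip (Case 2 Skip (Seq (Push 3 true) (Push 5 true)) Skip) Skip))))
   (Mv 3 0)).

Lemma exec_load_loop p u (w v : seq bool) r : exec
   (Loop 3 (Seq (Push 2 false) (Push 2 true))
           (Seq (Push 2 false) (Seq (Push 2 false) (Seq (Push 2 true) (Push 2 true)))))
   [:: p; u; tcode (enc v) ++ r; rev w; [::]; [::]]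
   [:: p; u; tcode (enc (w ++ v)) ++ r; [::]; [::]; [::]].
Proof.
elim/last_ind: w v => [|w b IH] v; first exact: ExLoopE.
rewrite rev_rcons cat_rcons.
apply: (@ExLoopB _ _ _ _ _ _ b (rev w)); [by [] | | exact: (IH (b :: v))].
by case: b; do !ex_step.
Qed.

Lemma exec_load1 (p w : seq bool) : exec (TLoad 1)
   [:: p; w; [::]; [::]; [::]; [::]] [:: p; [::]; tcode (enc w); [::]; [::]; [::]].
Proof.
apply: ExSeq; first exact: exec_Mv.
apply: ExSeq; first exact: ExPush.
by have := exec_load_loop p [::] w [::] [::]; rewrite !cats0.
Qed.

Lemma exec_load0 (w : seq bool) r : exec (TLoad 0)
   [:: w; [::]; r; [::]; [::]; [::]] (tstate (tcode (enc w) ++ r)).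
Proof.
apply: ExSeq; first exact: exec_Mv.
apply: ExSeq; first exact: ExPush.
by have := exec_load_loop [::] [::] w [::] r; rewrite !cats0.
Qed.

Lemma exec_store (w : seq bool) : exec TStore (tstate (tcode (enc w)))
  [:: w; [::]; [::]; [::]; [::]; [::]].
Proof.
apply: ExSeq; first exact: ExPush.
apply: ExSeq; last first.
  have : exec (Mv 3 0) [:: [::]; [::]; [::]; rev w; [::]; [::]] [:: w; [::]; [::]; [::]; [::]; [::]].
    by apply: exec_Mv; rewrite //= revK cats0.
  exact.
have H v : exec (Loop 5 Skip (Case 2 Skip Skip
    (Case 2 Skip (Seq (Push 3 false) (Push 5 true))
       (Case 2 Skip (Case 2 Skip (Seq (Push 3 true) (Push 5 true)) Skip) Skip))))
    [:: [::]; [::]; tcode (enc w); v; [::]; [:: true]]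
    [:: [::]; [::]; [::]; rev w ++ v; [::]; [::]].
  elim: w v => [|b w IH] v.
    apply: (@ExLoopB _ _ _ _ _ _ true [::]); [by [] | | exact: ExLoopE].
    by do !ex_step.
  rewrite rev_cons cat_rcons.
  apply: (@ExLoopB _ _ _ _ _ _ true [::]); [by [] | | exact: (IH (b :: v))].
  by case: b; do !ex_step.
by have := H [::]; rewrite cats0.
Qed.

(** Unbounded search becomes a machine: a [TWhile] loop raises the stage until [F] yields a value,
    between the loading of the arguments and the storing of the result. *)
Lemma cpt_tm_search (F : (seq bool * seq bool) * nat -> option (seq bool)) :
  cpt F -> exists V : TM, forall p u s w,
    F ((p, u), s) = Some w -> (forall s', s' < s -> F ((p, u), s') = None) ->
    tm_eval V [:: p; u] w.
Proof.
move=> HF; pose T := ((seq bool * seq bool) * nat)%type.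
have [cI [wI HI]] : cpt (fun z : seq bool * seq bool => (z, 0)) by cpt_solve.
have [cB HB] : cpt (fun z : T => ~~ isSome (F z)) by cpt_solve.
have [cG HG] : cpt (fun z : T => (z.1, z.2.+1)) by cpt_solve.
have [cO [wO HO]] : cpt (fun z : T => odflt [::] (F z)) by cpt_solve.
pose c := Seq (Seq (TLoad 1) (Seq (TLoad 0) TCons)) (Seq (Seq cI (Seq (TWhile cB cG) cO)) TStore).
exists (cmd_tm 5 c) => p u s w Fs Flt.
have ex : exec c [:: p; u; [::]; [::]; [::]; [::]] [:: w; [::]; [::]; [::]; [::]; [::]].
  apply: (@ExSeq _ _ _ (tstate (tcode (enc (p, u))))).
    apply: ExSeq; first exact: exec_load1.
    apply: ExSeq; first exact: exec_load0.
    exact: exec_push_eq.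
  apply: ExSeq (exec_store w).
  have it m : iter m (fun z : T => (z.1, z.2.+1)) ((p, u), 0) = ((p, u), m).
    by elim: m => //= m ->.
  have W : trel (TWhile cB cG) [:: enc ((p, u), 0)] [:: enc ((p, u), s)].
    have := trel_while HB HG (n := s) (x := ((p, u), 0)); rewrite it; apply; last by rewrite Fs.
    by move=> m lt_m; rewrite it Flt.
  have /(_ [::]) := trel_seq (HI (p, u)) (trel_seq W (HO _)).
  by rewrite /tcodes /= !cats0 Fs.
have wf : cmd_wf 5 c by rewrite /= wI wO (proj1 HB) (proj1 HG).
have [k Hk] := exec_tm wf ex; exists k; rewrite -Hk.
(* Missing arguments are read as empty words, so padding the argument list with empty stacks gives
   the same initial configuration. *)
by congr tm_run; congr pair; apply/ffunP => j; rewrite !ffunE;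
  congr tape_of_bits; case: j => [[|[|[|[|[|[|]]]]]]].
Qed.

Lemma C_le (U : universalTM) (w u p : bits) : tm_eval U [:: p; u] w -> C U w u <= size p.
Proof.
move=> H; rewrite /C; case: ex_minnP => m _; apply; apply/asboolP.
by exists p.
Qed.

Lemma C_program (U : universalTM) (w u : bits) :
  exists2 p, size p = C U w u & tm_eval U [:: p; u] w.
Proof. by rewrite /C; case: ex_minnP => m /asboolP. Qed.

(** Only the parameters are made self-delimiting; the index comes last and costs just its binary
    length, which keeps it out of the error term. *)
Definition enum_program (ns : seq nat) (q : nat) : bits :=
  code_bits (code_seq [seq code_nat k | k <- ns]) ++ code_nat q.

(** The program names the parameters and the position of [w]. The machine waits for a stage at which
    the list is long enough; as later lists only extend earlier ones, the entry found there is
    [w]. *)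
Lemma C_enum (U : universalTM) (L : (seq nat * seq bool) -> nat -> seq (seq bool)) :
  cpt (fun z : (seq nat * seq bool) * nat => L z.1 z.2) ->
  exists c, forall ns u s w,
    (forall s, prefix (L (ns, u) s) (L (ns, u) s.+1)) ->
    w \in L (ns, u) s ->
    C U w u <= size (enum_program ns (index w (L (ns, u) s))) + c.
Proof.
move=> HL.
pose ns_of (p : seq bool) := [seq dec_nat v | v <- dec_seq (split_code p).1].
pose q_of (p : seq bool) := dec_nat (split_code p).2.
pose F (z : (seq bool * seq bool) * nat) :=
  let l := L (ns_of z.1.1, z.1.2) z.2 in
  if q_of z.1.1 < size l then Some (nth [::] l (q_of z.1.1)) else None.
have HF : cpt F.
  have Hn : cpt ns_of by rewrite /ns_of; cpt_solve.
  have Hq : cpt q_of by rewrite /q_of; cpt_solve.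
  have Hl : cpt (fun z : (seq bool * seq bool) * nat => L (ns_of z.1.1, z.1.2) z.2).
    apply: (cpt_comp (F := fun z : (seq bool * seq bool) * nat =>
       ((ns_of z.1.1, z.1.2), z.2)) _ HL); cpt_solve.
  rewrite /F; cpt_solve.
have [V HV] := cpt_tm_search HF.
have [c Hc] := utm_universal U V.
exists c => ns u s w mono w_in.
set q := index _ _; set p := enum_program _ _.
have En : ns_of p = ns.
  by rewrite /ns_of split_codeE code_seqK -map_comp map_id_in // => k _; exact: code_natK.
have Eq : q_of p = q by rewrite /q_of split_codeE code_natK.
have pre m n : m <= n -> prefix (L (ns, u) m) (L (ns, u) n).
  move=> /subnK <-; elim: (n - m) => [|d IH]; first exact: prefix_refl.
  exact: prefix_trans IH (mono _).
have ex : exists s, isSome (F ((p, u), s)).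
  by exists s; rewrite /F /= En Eq index_mem w_in.
case: (ex_minnP ex) => s0 Fs0 min.
have Fw : F ((p, u), s0) = Some w.
  move: Fs0; rewrite /F /= En Eq; case: ifP => // lt_q _; congr Some.
  rewrite -[RHS](nth_index [::] w_in) -/q.
  have [le_s|lt_s] := leqP s0 s.
    by have /prefixP[t ->] := pre _ _ le_s; rewrite nth_cat lt_q.
  have /prefixP[t ->] := pre _ _ (ltnW lt_s); by rewrite nth_cat index_mem w_in.
have ev : tm_eval V [:: p; u] w.
  apply: HV Fw _ => s' lt_s'; case E: (F _) => [v|//].
  by have := min s'; rewrite E => /(_ isT); rewrite leqNgt lt_s'.
have [p' le_p' /C_le] := Hc _ _ _ ev.
by move=> le_C; apply: leq_trans le_C le_p'.
Qed.

Lemma C_le_size (U : universalTM) : exists c, forall w u, C U w u <= size w + c.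
Proof.
pose V := @MakeTM 0 unit tt (fun _ _ => None).
have [c Hc] := utm_universal U V; exists c => w u.
have Vw : tm_eval V [:: w; u] w.
  exists 0; rewrite /= /tm_output /tm_init /= ffunE /=.
  by rewrite [X in Some X]tape_of_bitsK.
by have [q le_q /C_le le_C] := Hc _ _ _ Vw; apply: leq_trans le_C le_q.
Qed.

(** * Online multiplicative weights *)

(* The weight [(1 + 1/E)^h], for [E = 2^a], scaled by [E^(2^k)]. *)
Definition wt (k a h : nat) : nat := (2 ^ a).+1 ^ h * (2 ^ a) ^ (2 ^ k - h).

Lemma wtS k a h : h < 2 ^ k -> 2 ^ a * wt k a h.+1 = 2 ^ a * wt k a h + wt k a h.
Proof.
move=> lt_h; rewrite /wt; set E := 2 ^ a.
have -> : 2 ^ k - h = (2 ^ k - h.+1).+1 by lia.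
by rewrite !expnS; set u := _ ^ h; set v := _ ^ (_ - _); nia.
Qed.

Lemma leq_wt k a h h' : h <= h' -> h' <= 2 ^ k -> wt k a h <= wt k a h'.
Proof.
move=> /subnK <-; elim: (h' - h) => [|d IH] // le_h.
apply: leq_trans (IH _) _; first by lia.
have E0 : 0 < 2 ^ a by rewrite expn_gt0.
by rewrite -(leq_pmul2l E0) addSn wtS ?leq_addr //; lia.
Qed.

Lemma leq_expn_base m n e : m <= n -> m ^ e <= n ^ e.
Proof. by move=> le_mn; case: e => // e; rewrite leq_exp2r. Qed.

(** This is [(1 + 1/E)^E >= 2], from the first two terms of the binomial expansion. *)
Lemma two_expn_leq E : 0 < E -> 2 * E ^ E <= E.+1 ^ E.
Proof.
have H n : E ^ n + n * E ^ n.-1 <= E.+1 ^ n.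
  elim: n => [|n IH]; first by rewrite !expn0.
  have : E.+1 * (E ^ n + n * E ^ n.-1) <= E.+1 ^ n.+1 by rewrite expnS leq_mul2l IH orbT.
  apply: leq_trans; rewrite /= expnS.
  case: n IH => [|n] _ /=; first by lia.
  rewrite !expnS; set u := E ^ n; nia.
move=> E0; apply: leq_trans (H E).
by case: E E0 {H} => // e _ /=; rewrite [in X in _ <= _ + X]mulnC -expnSr addnn mul2n.
Qed.

(** With [E = 2^a], the weight doubles at least once in every [E] hits. After [E * (n + a)] hits a
    single string would have [2^n * E] times its initial weight, contrary to the assumed upper
    bound. *)
Lemma wt_lt_bound k a n h : h <= 2 ^ k -> 2 ^ k * wt k a h < 2 ^ n * (2 ^ a) ^ (2 ^ k).+1 ->
  h < 2 ^ a * (n + a).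
Proof.
move=> le_h lt_w; rewrite ltnNge; apply/negP => le_m; move: lt_w; rewrite ltnNge => /negP; apply.
set E := 2 ^ a in le_m *; have E0 : 0 < E by rewrite expn_gt0.
have K0 : 0 < 2 ^ k by rewrite expn_gt0.
apply: leq_trans (leq_pmull _ K0).
have -> : E ^ (2 ^ k).+1 = E * (E ^ h * E ^ (2 ^ k - h)) by rewrite -expnD subnKC // expnS.
rewrite /wt -/E !mulnA.
rewrite leq_mul2r; apply/orP; right.
have -> : 2 ^ n * E = 2 ^ (n + a) by rewrite expnD.
rewrite -(subnKC le_m) !expnD; move: (h - _) => d.
have H1 : 2 ^ (n + a) * E ^ (E * (n + a)) <= E.+1 ^ (E * (n + a)).
  by rewrite !expnM -expnMn leq_expn_base // two_expn_leq.
rewrite mulnA; apply: leq_mul; [by rewrite -expnD | exact: leq_expn_base].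
Qed.

Section Online.
Variables (T : finType) (S : nat -> {set T}) (k a : nat).
Implicit Types (Us L : seq nat) (x : T).

Definition hits Us x := count (fun j => x \in S j) Us.

Definition wt_set Us j := \sum_(x in S j) wt k a (hits Us x).

(** The weight of the set is compared with a fraction [2^(a-k)] of the initial total
    [#|T| * (2^a)^(2^k)]. The current total is at most twice as large during [2^k] arrivals. For
    [a = 0] nothing counts as uncovered. *)
Definition uncov_test Us j :=
  (0 < a) && (2 ^ k * wt_set Us j < #|T| * (2 ^ a) ^ (2 ^ k).+1).

Definition uncov_step Us j := if uncov_test Us j then rcons Us j else Us.

Definition uncov L := foldl uncov_step [::] L.

Lemma uncov_rcons L j : uncov (rcons L j) = uncov_step (uncov L) j.
Proof. by rewrite /uncov -cats1 foldl_cat. Qed.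

Lemma size_uncov L : size (uncov L) <= size L.
Proof.
elim/last_ind: L => // L j IH; rewrite uncov_rcons size_rcons /uncov_step.
by case: ifP => _; rewrite ?size_rcons ?ltnS //; apply: leqW.
Qed.

Lemma hits_rcons Us j x : hits (rcons Us j) x = hits Us x + (x \in S j).
Proof. by rewrite /hits -cats1 count_cat /= addn0. Qed.

Lemma leq_hits Us x : hits Us x <= size Us.
Proof. exact: count_size. Qed.

Lemma leq_hits_uncov L x : size L <= 2 ^ k -> hits (uncov L) x <= 2 ^ k.
Proof.
by move=> le_L; apply: leq_trans (leq_hits _ _) (leq_trans (size_uncov _) le_L).
Qed.

(** An uncovered set adds [2^-a] times its weight to the total, which by the test is less than a
    [2^-k] fraction of the initial total; each arrival can do so at most once. *)
Lemma sum_wt_uncov L : size L <= 2 ^ k ->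
  2 ^ k * \sum_x wt k a (hits (uncov L) x) <=
    (2 ^ k + size L) * (#|T| * (2 ^ a) ^ (2 ^ k)).
Proof.
elim/last_ind: L => [|L j IH] le_L.
  rewrite addn0 leq_mul2l; apply/orP; right.
  rewrite (eq_bigr (fun=> (2 ^ a) ^ (2 ^ k))) ?sum_nat_const //.
  by move=> x _; rewrite /wt /hits /= subn0 expn0 mul1n.
rewrite size_rcons in le_L *.
have {}IH := IH (ltnW le_L).
rewrite uncov_rcons /uncov_step; case: ifP => [/andP[a0 test]|_]; last first.
  by apply: leq_trans IH _; rewrite leq_mul2r leq_add2l leqnSn orbT.
set Us := uncov L in IH test *.
have hU x : hits Us x < 2 ^ k.
  by apply: leq_ltn_trans (leq_hits _ _) (leq_ltn_trans (size_uncov _) le_L).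
have E0 : 0 < 2 ^ a by rewrite expn_gt0.
have sumE : 2 ^ a * \sum_x wt k a (hits (rcons Us j) x) =
    2 ^ a * \sum_x wt k a (hits Us x) + wt_set Us j.
  rewrite /wt_set !big_distrr /= [X in _ = _ + X]big_mkcond -big_split /=.
  apply: eq_bigr => x _; rewrite hits_rcons; case: (x \in S j) => /=.
    by rewrite addn1 wtS.
  by rewrite !addn0.
rewrite -(leq_pmul2l E0) mulnCA sumE mulnDr.
rewrite expnS in test.
move: IH test; set A := \sum_x _; set B := wt_set _ _; set K := 2 ^ k.
by set E := 2 ^ a; set Z := E ^ K; nia.
Qed.

(** The set failed the test on arrival, so its weight was large then, and weights never decrease. *)
Lemma wt_set_covered L j : size L <= 2 ^ k -> 0 < a -> j \in L -> j \notin uncov L ->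
  #|T| * (2 ^ a) ^ (2 ^ k).+1 <= 2 ^ k * wt_set (uncov L) j.
Proof.
move=> le_L a0; elim/last_ind: L le_L => // L i IH le_L.
rewrite size_rcons in le_L; rewrite mem_rcons inE uncov_rcons.
have mono : wt_set (uncov L) j <= wt_set (uncov_step (uncov L) i) j.
  rewrite /wt_set; apply: leq_sum => x _; apply: leq_wt.
    by rewrite /uncov_step; case: ifP => // _; rewrite hits_rcons leq_addr.
  by rewrite -uncov_rcons leq_hits_uncov ?size_rcons.
case/orP => [/eqP ->|jL] jU; last first.
  apply: leq_trans (IH (ltnW le_L) jL _) _; last by rewrite leq_mul2l mono orbT.
  by move: jU; rewrite /uncov_step; case: ifP => // _; rewrite mem_rcons inE negb_or => /andP[].
move: jU; rewrite {1}/uncov_step; case: ifP => [_|test _]; first by rewrite mem_rcons inE eqxx.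
rewrite /uncov_step test; move: test; rewrite /uncov_test a0 /= => /negbT.
by rewrite -leqNgt.
Qed.

(** A string gains a hit only when a set containing it passes the test. Its own weight is then
    small, so [wt_lt_bound] gives a strict bound before the hit, which leaves room for it. *)
Lemma hits_uncov L x n : #|T| = 2 ^ n -> size L <= 2 ^ k ->
  hits (uncov L) x <= 2 ^ a * (n + a).
Proof.
move=> cardT; elim/last_ind: L => // L j IH; rewrite size_rcons => le_L.
have {}IH := IH (ltnW le_L).
rewrite uncov_rcons /uncov_step; case: ifP => // /andP[a0 test].
rewrite hits_rcons; case xS: (x \in S j); last by rewrite addn0.
rewrite addn1; apply: (@wt_lt_bound k); first by rewrite leq_hits_uncov // ltnW.
rewrite -cardT; apply: leq_ltn_trans test.
by rewrite leq_mul2l /wt_set (bigD1 x) //= leq_addr orbT.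
Qed.

Lemma uncov_a0 L : a = 0 -> uncov L = [::].
Proof.
move=> a0; elim/last_ind: L => // L j IH.
by rewrite uncov_rcons IH /uncov_step /uncov_test a0.
Qed.

(** For [a > 0] the final weights serve; their total is at most twice the initial one, whence the
    exponent [k.+1]. For [a = 0] every arrival is covered and the weights are chosen directly. *)
Lemma covering_weights L : size L <= 2 ^ k -> 0 < size L ->
  (forall j, j \in L -> S j != set0) ->
  exists W : T -> nat, 0 < \sum_x W x /\
    forall j, j \in L -> j \notin uncov L ->
      2 ^ a * \sum_x W x <= 2 ^ k.+1 * \sum_(x in S j) W x.
Proof.
move=> le_L L0 Sn0.
have [a0|a0] := posnP a.
  have [j0 j0L] : exists j, j \in L by case: L L0 {le_L Sn0} => // j L _; exists j; rewrite inE eqxx.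
  have [t0 _] := set0Pn _ (Sn0 _ j0L).
  (* one unit of weight at a point of each arrived set *)
  pose rep j := odflt t0 [pick x in S j].
  have repP j : j \in L -> rep j \in S j.
    by move=> /Sn0 /set0Pn [x xS]; rewrite /rep; case: pickP => //= /(_ x); rewrite xS.
  pose W x := count (fun j => rep j == x) L.
  have sumW : \sum_x W x = size L.
    rewrite /W; under eq_bigr do rewrite -sum1_count big_mkcond.
    rewrite exchange_big /= -sum1_size; apply: eq_bigr => j _.
    by rewrite -big_mkcond (big_pred1 (rep j)) // => x; rewrite eq_sym.
  exists W; rewrite sumW; split=> // j jL _.
  rewrite a0 expn0 mul1n; apply: leq_trans le_L _.
  apply: leq_trans (leq_pexp2l _ (leqnSn _)) _ => //.
  apply: leq_pmulr; rewrite (bigD1 (rep j)) ?repP //=.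
  by apply: leq_trans (leq_addr _ _); rewrite /W -has_count; apply/hasP; exists j.
exists (fun x => wt k a (hits (uncov L) x)).
have le_sum : \sum_x wt k a (hits (uncov L) x) <= 2 * (#|T| * (2 ^ a) ^ (2 ^ k)).
  have K0 : 0 < 2 ^ k by rewrite expn_gt0.
  rewrite -(leq_pmul2l K0); apply: leq_trans (sum_wt_uncov le_L) _.
  by move: le_L; set Z := #|T| * _; set K := 2 ^ k; nia.
split.
  have [j0 j0L] : exists j, j \in L by case: L L0 {le_L Sn0 le_sum} => // j L _; exists j; rewrite inE eqxx.
  have [t0 _] := set0Pn _ (Sn0 _ j0L).
  rewrite (bigD1 t0) //=; apply: leq_trans (leq_addr _ _).
  by rewrite /wt muln_gt0 !expn_gt0.
move=> j jL jU; have := wt_set_covered le_L a0 jL jU.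
rewrite !expnS /wt_set; move: le_sum; set A := \sum_x _; set B := \sum_(x in _) _.
set E := 2 ^ a; set Z := E ^ _; set K := 2 ^ k; nia.
Qed.

End Online.

(** * Product weights on the cells of rectangles *)

Lemma sum_dffun_prod (I : finType) (T_ : I -> finType) (W : forall i, T_ i -> nat) :
  \sum_(z : {dffun forall i, T_ i}) \prod_i W i (z i) = \prod_i \sum_x W i x.
Proof.
rewrite (reindex (@dffun_of_fprod I T_)) /=; last exact/onW_bij/dffun_of_fprod_bij.
pose P_ i := [ffun x : T_ i => W i x].
transitivity (\sum_(t : fprod T_) \prod_(i in I) P_ i (t i)).
  apply: eq_bigr => t _; apply: eq_bigr => i _.
  by rewrite /dffun_of_fprod !ffunE.
(* Distributivity is applied to functions into the tagged sum of all [T_ i], with coordinate [i]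
   confined to its own fibre. *)
rewrite (big_fprod 1 _ P_) -(bigA_distr_big_dep (fun i => mem (tagged_with T_ i))
   (fun i j => untag 0 (P_ i) j)).
apply: eq_bigr => i _; rewrite -(big_tag (fun i => P_ i)).
by apply: eq_bigr => x _; rewrite ffunE.
Qed.

Lemma sum_setXn_prod (I : finType) (T_ : I -> finType) (A : forall i, {set T_ i})
    (W : forall i, T_ i -> nat) :
  \sum_(z in setXn A) \prod_i W i (z i) = \prod_i \sum_(x in A i) W i x.
Proof.
pose W' i x := if x \in A i then W i x else 0.
transitivity (\prod_i \sum_x W' i x); last by apply: eq_bigr => i _; rewrite -big_mkcond.
rewrite -sum_dffun_prod big_mkcond; apply: eq_bigr => z _.
case: setXnP => [zA|nzA]; first by apply: eq_bigr => i _; rewrite /W' zA.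
have /existsP [i ziA] : [exists i, z i \notin A i].
  by rewrite -negb_forall; apply/forallP.
by rewrite (bigD1 i) //= /W' (negbTE ziA) mul0n.
Qed.

(* Double counting of the weighted incidences between cells and rectangles. *)
Lemma weighted_rect_count (I : finType) (T_ : I -> finType) (J : eqType) (G : seq J)
    (A : J -> forall i, {set T_ i}) (W : forall i, T_ i -> nat) (rho : nat) :
  (forall j, j \in G -> forall z, z \in setXn (A j) ->
      count (fun j' => z \in setXn (A j')) G <= rho) ->
  \sum_(j <- G) \prod_i \sum_(x in A j i) W i x <= rho * \prod_i \sum_x W i x.
Proof.
move=> le_rho; rewrite -sum_dffun_prod big_distrr /=.
under eq_bigr do rewrite -sum_setXn_prod big_mkcond /=.
rewrite exchange_big /=; apply: leq_sum => z _.
rewrite -big_mkcond /= big_const_seq iter_addn_0 mulnC leq_mul2r; apply/orP; right.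
(* The thickness bound is assumed only for cells of rectangles in [G]; all other cells are counted
   zero times. *)
have [/hasP[j jG zj]|] := boolP (has (fun j => z \in setXn (A j)) G).
  exact: le_rho jG _ zj.
by rewrite has_count -leqNgt leqn0 => /eqP ->.
Qed.

(** * The enumerations *)

Notation word := (seq bool).
(* A protocol as the list of its rectangles, each one the list of its cells. *)
Notation rlist := (seq (seq (seq word))).

Definition rects_of (P : word) : rlist :=
  [seq [seq dec_seq c | c <- dec_seq B] | B <- dec_seq (nth [::] (dec_seq P) 0)].

Definition rproj (rs : rlist) (i j : nat) : seq word :=
  undup [seq nth [::] c i | c <- nth [::] rs j].

Definition rhits (rs : rlist) (i : nat) (Us : seq nat) (x : word) : nat :=
  count (fun j => x \in rproj rs i j) Us.

(** The length of the strings of party [i] is read off the first cell of rectangle [j], so that the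
    power of 2 is the number of these strings. *)
Definition rtest (rs : rlist) (i k a : nat) (Us : seq nat) (j : nat) : bool :=
  (0 < a) && (2 ^ k * sumn [seq wt k a (rhits rs i Us x) | x <- rproj rs i j]
    < 2 ^ size (nth [::] (head [::] (nth [::] rs j)) i) * (2 ^ a) ^ (2 ^ k).+1).

Definition runcov (rs : rlist) (i k a : nat) (L : seq nat) : seq nat :=
  foldl (fun Us j => if rtest rs i k a Us j then rcons Us j else Us) [::] L.

Definition all_words (k : nat) : seq word :=
  iter k (fun l => map (cons true) l ++ map (cons false) l) [:: [::]].

Definition rthin (rs : rlist) (r j : nat) : bool :=
  all (fun c => count (fun B : seq (seq word) => c \in B) rs <= 2 ^ r) (nth [::] rs j).

(** A value is emitted at the moment its count becomes exactly [h]: it appears once, and the output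
    only grows at its end as [ys] does. *)
Definition heavy (h : nat) (ys : seq word) : seq word :=
  (foldl (fun st y => (rcons st.1 y,
      if count (fun z => z == y) (rcons st.1 y) == h then rcons st.2 y else st.2))
    ([::], [::]) ys).2.

Section Enumerations.
Variables (U Mf : TM) (l : nat).

Definition label (rs : rlist) (s j : nat) : option word :=
  tm_run s (tm_init Mf (head [::] (nth [::] rs j))).

(** Programs of exactly [k] bits leave room for at most [2^k] arrivals. A rectangle also waits for
    its label, so that the labels of arrived rectangles never change afterwards. *)
Definition ready (P : word) (k s j : nat) : bool :=
  [&& nth [::] (rects_of P) j != [::], isSome (label (rects_of P) s j)
    & has (fun p => tm_run s (tm_init U [:: p; P]) == Some (code_nat j) :> option word)
        (all_words k)].

Definition arrivals (P : word) (k s : nat) : seq nat :=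
  foldl (fun L s' => L ++ [seq j <- iota 0 (size (rects_of P)) | ready P k s' j & j \notin L])
    [::] (iota 0 s).

Definition covered (P : word) (k r : nat) (aa : seq nat) (s : nat) : seq nat :=
  [seq j <- arrivals P k s |
    all (fun i => j \notin runcov (rects_of P) i k (nth 0 aa i) (arrivals P k s)) (iota 0 l)
    && rthin (rects_of P) r j].

Definition uncovered (P : word) (k i a : nat) (x : word) (s : nat) : seq nat :=
  [seq j <- runcov (rects_of P) i k a (arrivals P k s) | x \in rproj (rects_of P) i j].

(** The parameters are [k], [r] and then all the rates [a_i]; the condition is the protocol. *)
Definition enum_t (z : seq nat * word) (s : nat) : seq word :=
  [seq code_nat j | j <- covered z.2 (nth 0 z.1 0) (nth 0 z.1 1) (behead (behead z.1)) s].

Definition labels (P : word) (k i a : nat) (x : word) (s : nat) : seq word :=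
  [seq odflt [::] (label (rects_of P) s j) | j <- uncovered P k i a x s].

(** The parameters are [k], [i], [a_i] and the exponent of the frequency threshold; the condition
    codes [x_i] and the protocol. *)
Definition enum_y_x (z : seq nat * word) (s : nat) : seq word :=
  heavy (2 ^ nth 0 z.1 3)
    (labels (nth [::] (dec_seq z.2) 1) (nth 0 z.1 0) (nth 0 z.1 1) (nth 0 z.1 2)
       (nth [::] (dec_seq z.2) 0) s).

Definition enum_t_xy (z : seq nat * word) (s : nat) : seq word :=
  [seq code_nat j
  | j <- [seq j <- uncovered (nth [::] (dec_seq z.2) 2) (nth 0 z.1 0) (nth 0 z.1 1)
                     (nth 0 z.1 2) (nth [::] (dec_seq z.2) 0) s
         | odflt [::] (label (rects_of (nth [::] (dec_seq z.2) 2)) s j)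
           == nth [::] (dec_seq z.2) 1]].

End Enumerations.

(** * Computability of the enumerations *)

Lemma cpt_wt {X : Type} `{EX : Enc X} (k a h : X -> nat) :
  cpt k -> cpt a -> cpt h -> cpt (fun x => wt (k x) (a x) (h x)).
Proof. by move=> Hk Ha Hh; rewrite /wt; cpt_solve. Qed.

Lemma cpt_rects_of {X : Type} `{EX : Enc X} (P : X -> word) :
  cpt P -> cpt (fun x => rects_of (P x)).
Proof. by move=> HP; rewrite /rects_of; cpt_solve. Qed.

Lemma cpt_rproj {X : Type} `{EX : Enc X} (rs : X -> rlist) (i j : X -> nat) :
  cpt rs -> cpt i -> cpt j -> cpt (fun x => rproj (rs x) (i x) (j x)).
Proof. by move=> Hr Hi Hj; rewrite /rproj; cpt_solve. Qed.

Lemma cpt_rthin {X : Type} `{EX : Enc X} (rs : X -> rlist) (r j : X -> nat) :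
  cpt rs -> cpt r -> cpt j -> cpt (fun x => rthin (rs x) (r x) (j x)).
Proof. by move=> Hr Hi Hj; rewrite /rthin; cpt_solve. Qed.

Lemma cpt_all_words {X : Type} `{EX : Enc X} (k : X -> nat) :
  cpt k -> cpt (fun x => all_words (k x)).
Proof. by move=> Hk; rewrite /all_words; cpt_solve. Qed.

Lemma cpt_heavy {X : Type} `{EX : Enc X} (h : X -> nat) (ys : X -> seq word) :
  cpt h -> cpt ys -> cpt (fun x => heavy (h x) (ys x)).
Proof. by move=> Hh Hy; rewrite /heavy; cpt_solve. Qed.

Ltac cpt_step_stage := fail.

Ltac cpt_step_rect ::=
  lazymatch goal with
  | |- cpt (fun x => wt (@?f x) (@?g x) (@?h x)) => apply: (@cpt_wt _ _ f g h)
  | |- cpt (fun x => rects_of (@?f x)) => apply: (@cpt_rects_of _ _ f)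
  | |- cpt (fun x => rproj (@?f x) (@?g x) (@?h x)) => apply: (@cpt_rproj _ _ f g h)
  | |- cpt (fun x => rthin (@?f x) (@?g x) (@?h x)) => apply: (@cpt_rthin _ _ f g h)
  | |- cpt (fun x => all_words (@?f x)) => apply: (@cpt_all_words _ _ f)
  | |- cpt (fun x => heavy (@?f x) (@?g x)) => apply: (@cpt_heavy _ _ f g)
  | _ => cpt_step_stage
  end.

Lemma cpt_rhits {X : Type} `{EX : Enc X} (rs : X -> rlist) (i : X -> nat)
    (Us : X -> seq nat) (w : X -> word) :
  cpt rs -> cpt i -> cpt Us -> cpt w -> cpt (fun x => rhits (rs x) (i x) (Us x) (w x)).
Proof. by move=> *; rewrite /rhits; cpt_solve. Qed.

Lemma cpt_runcov {X : Type} `{EX : Enc X} (rs : X -> rlist) (i k a : X -> nat)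
    (L : X -> seq nat) :
  cpt rs -> cpt i -> cpt k -> cpt a -> cpt L ->
  cpt (fun x => runcov (rs x) (i x) (k x) (a x) (L x)).
Proof.
move=> Hrs Hi Hk Ha HL; rewrite /runcov /rtest; cpt_solve.
apply: cpt_rhits; cpt_solve.
Qed.

Lemma cpt_label {X : Type} `{EX : Enc X} (Mf : TM) (rs : X -> rlist) (s j : X -> nat) :
  cpt rs -> cpt s -> cpt j -> cpt (fun x => label Mf (rs x) (s x) (j x)).
Proof. by move=> *; rewrite /label; apply: cpt_tm_run; cpt_solve. Qed.

Lemma cpt_arrivals {X : Type} `{EX : Enc X} (U Mf : TM) (P : X -> word) (k s : X -> nat) :
  cpt P -> cpt k -> cpt s -> cpt (fun x => arrivals U Mf (P x) (k x) (s x)).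
Proof.
move=> HP Hk Hs; rewrite /arrivals /ready; cpt_solve.
  by apply: cpt_label; cpt_solve.
by apply: cpt_tm_run; cpt_solve.
Qed.

Ltac cpt_step_stage ::=
  lazymatch goal with
  | |- cpt (fun x => runcov (@?rs x) (@?i x) (@?k x) (@?a x) (@?L x)) =>
      apply: (@cpt_runcov _ _ rs i k a L)
  | |- cpt (fun x => label ?M (@?rs x) (@?i x) (@?k x)) => apply: (@cpt_label _ _ M rs i k)
  | |- cpt (fun x => arrivals ?U ?M (@?rs x) (@?i x) (@?k x)) =>
      apply: (@cpt_arrivals _ _ U M rs i k)
  end.

Lemma cpt_enum_t U Mf l :
  cpt (fun z : (seq nat * word) * nat => enum_t U Mf l z.1 z.2).
Proof. by rewrite /enum_t /covered; cpt_solve. Qed.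

Lemma cpt_enum_y_x U Mf :
  cpt (fun z : (seq nat * word) * nat => enum_y_x U Mf z.1 z.2).
Proof. by rewrite /enum_y_x /labels /uncovered; cpt_solve. Qed.

Lemma cpt_enum_t_xy U Mf :
  cpt (fun z : (seq nat * word) * nat => enum_t_xy U Mf z.1 z.2).
Proof. by rewrite /enum_t_xy /uncovered; cpt_solve. Qed.

(** * Monotonicity of the enumerations in the stage *)

Lemma tm_run_leq (M : TM) s s' (c : config M) w :
  s <= s' -> tm_run s c = Some w -> tm_run s' c = Some w.
Proof.
elim: s s' c => [|s IH] [|s'] c //=; case: (tm_step c) => // c' le_s; exact: IH.
Qed.

Lemma tm_eval_stage (M : TM) ws w :
  tm_eval M ws w -> exists s0, forall s, s0 <= s -> tm_run s (tm_init M ws) = Some w.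
Proof. by move=> [s0 H]; exists s0 => s le_s; apply: tm_run_leq H. Qed.

Lemma mem_all_words (p : word) : p \in all_words (size p).
Proof.
elim: p => [|b p IH]; first by rewrite inE.
by rewrite /all_words /= -/(all_words _) mem_cat; apply/orP; case: b; [left|right]; apply: map_f.
Qed.

Lemma size_all_words k : size (all_words k) = 2 ^ k.
Proof.
elim: k => // k IH; rewrite /all_words /= -/(all_words _).
by rewrite size_cat !size_map IH expnS mul2n addnn.
Qed.

Lemma prefix_map (T T' : eqType) (f : T -> T') s s' :
  prefix s s' -> prefix (map f s) (map f s').
Proof. by move=> /prefixP[t ->]; rewrite map_cat prefix_prefix. Qed.

Lemma prefix_filter (T : eqType) (p : pred T) s s' :
  prefix s s' -> prefix (filter p s) (filter p s').
Proof. by move=> /prefixP[t ->]; rewrite filter_cat prefix_prefix. Qed.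

(** The process is online: the verdict on a rectangle depends only on earlier arrivals, so later
    ones merely append to the list. *)
Lemma runcov_cat rs i k a L L' :
  exists2 R, runcov rs i k a (L ++ L') = runcov rs i k a L ++ R & {subset R <= L'}.
Proof.
rewrite /runcov foldl_cat; move: (foldl _ _ L) => Us.
elim: L' Us => [|j L' IH] Us /=; first by exists [::]; rewrite ?cats0.
have [R -> sub] := IH (if rtest rs i k a Us j then rcons Us j else Us).
case: ifP => _; last by exists R => // j' /sub; rewrite inE orbC => ->.
exists (j :: R); first by rewrite cat_rcons.
by move=> j'; rewrite !inE => /orP[->|/sub ->] //; rewrite orbT.
Qed.

Lemma heavy_rcons h ys y :
  heavy h (rcons ys y) = if (count_mem y ys).+1 == h then rcons (heavy h ys) y else heavy h ys.
Proof.
have E (zs : seq word) : (foldl (fun st y => (rcons st.1 y,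
      if count (fun z => z == y) (rcons st.1 y) == h then rcons st.2 y else st.2))
    ([::], [::]) zs).1 = zs.
  by elim/last_ind: zs => // zs z IH; rewrite -cats1 foldl_cat /= IH cats1.
rewrite /heavy -cats1 foldl_cat /= E -cats1 count_cat /= eqxx !addn0 addn1 //.
Qed.

Lemma heavy_prefix h ys ys' : prefix ys ys' -> prefix (heavy h ys) (heavy h ys').
Proof.
move=> /prefixP[t ->]; elim/last_ind: t => [|t y IH]; first by rewrite cats0 prefix_refl.
rewrite -rcons_cat heavy_rcons; case: ifP => // _.
exact: prefix_trans IH (prefix_rcons _ _).
Qed.

Lemma count_mem_rcons (T : eqType) (ys : seq T) y z :
  count_mem z (rcons ys y) = count_mem z ys + (y == z).
Proof. by rewrite -cats1 count_cat /= addn0. Qed.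

Lemma mem_heavy h ys y : 0 < h -> (y \in heavy h ys) = (h <= count_mem y ys).
Proof.
move=> h0; elim/last_ind: ys => [|ys z IH]; first by rewrite /heavy /= leqNgt h0.
rewrite heavy_rcons count_mem_rcons; have [->|nzy] := eqVneq z y.
  rewrite addn1; case: (_ =P h) => [<-|nE]; first by rewrite mem_rcons inE eqxx leqnn.
  by rewrite IH; apply/idP/idP; lia.
rewrite addn0 -IH; case: ifP => // _.
by rewrite mem_rcons inE eq_sym (negbTE nzy).
Qed.

Lemma uniq_heavy h ys : 0 < h -> uniq (heavy h ys).
Proof.
move=> h0; elim/last_ind: ys => // ys y IH; rewrite heavy_rcons.
case: (_ =P h) => // E; rewrite rcons_uniq IH andbT mem_heavy //; lia.
Qed.

(** Each heavy value occupies at least [h] places of [ys], and different values occupy different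
    places. *)
Lemma size_heavy h ys : 0 < h -> h * size (heavy h ys) <= size ys.
Proof.
move=> h0; have le_h : all (fun y => h <= count_mem y ys) (heavy h ys).
  by apply/allP => y; rewrite mem_heavy.
have U := uniq_heavy ys h0.
apply: (@leq_trans (\sum_(y <- heavy h ys) count_mem y ys)).
  rewrite -sum1_size big_distrr /= muln1 big_seq [leqRHS]big_seq.
  by apply: leq_sum => y yH; move/allP: le_h => /(_ _ yH).
under eq_bigr do rewrite -sum1_count big_mkcond.
rewrite exchange_big /= -sum1_size; apply: leq_sum => z _.
rewrite -big_mkcond /= sum1_count (eq_count (a2 := pred1 z)) => [|y /=]; last by rewrite eq_sym.
by rewrite count_uniq_mem // leq_b1.
Qed.

Section Stages.
Variables (U Mf : TM) (l : nat).
Implicit Types (P : word).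

Let arr := arrivals U Mf.

Lemma arrivalsS P k s :
  arr P k s.+1 = arr P k s ++
   [seq j <- iota 0 (size (rects_of P)) | ready U Mf P k s j & j \notin arr P k s].
Proof. by rewrite /arr /arrivals -addn1 iotaD foldl_cat. Qed.

Lemma ready_leq P k s s' j : s <= s' -> ready U Mf P k s j -> ready U Mf P k s' j.
Proof.
move=> le_s /and3P[n0 lab /hasP[p pk run]]; apply/and3P; split=> //.
  move: lab; rewrite /label; case E: (tm_run s _) => [w|] // _.
  by rewrite (tm_run_leq le_s E).
by apply/hasP; exists p => //; rewrite (tm_run_leq le_s (eqP run)).
Qed.

Lemma uniq_arrivals P k s : uniq (arr P k s).
Proof.
elim: s => // s IH; rewrite arrivalsS cat_uniq IH filter_uniq ?iota_uniq // andbT /=.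
by apply/hasPn => j; rewrite mem_filter => /andP[/andP[]].
Qed.

Lemma mem_arrivals P k s j :
  j \in arr P k s -> (j < size (rects_of P)) && ready U Mf P k s j.
Proof.
elim: s => // s IH; rewrite arrivalsS mem_cat => /orP[/IH /andP[-> R]|].
  exact: ready_leq R.
rewrite mem_filter mem_iota add0n => /andP[/andP[R _] /andP[_ ->]].
exact: ready_leq R.
Qed.

Lemma arrivals_mem P k s j :
  j < size (rects_of P) -> ready U Mf P k s j -> j \in arr P k s.+1.
Proof.
move=> lt_j R; rewrite arrivalsS mem_cat mem_filter R mem_iota add0n lt_j.
by case: (j \in arr P k s).
Qed.

(** Distinct indices have distinct codes, each printed by some program of length [k]; so they are at
    most as many as these programs. *)
Lemma size_arrivals P k s : size (arr P k s) <= 2 ^ k.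
Proof.
rewrite -size_all_words.
pose g p : option word := tm_run s (tm_init U [:: p; P]).
rewrite -(size_map (fun j => Some (code_nat j))) -(size_map g (all_words k)).
apply: uniq_leq_size.
  by rewrite map_inj_uniq ?uniq_arrivals // => j j' /Some_inj /(can_inj code_natK).
move=> w /mapP[j /mem_arrivals /andP[_ /and3P[_ _ /hasP[p pk /eqP run]]] ->].
by apply/mapP; exists p.
Qed.

Lemma label_arrivals P k s j : j \in arr P k s ->
  label Mf (rects_of P) s.+1 j = label Mf (rects_of P) s j.
Proof.
move=> /mem_arrivals /andP[_ /and3P[_ lab _]]; move: lab.
rewrite /label; case E: (tm_run s _) => [w|] // _.
exact: tm_run_leq (leqnSn s) E.
Qed.

Lemma mem_runcov rs i k a L j : j \in runcov rs i k a L -> j \in L.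
Proof.
move=> jU; have [R E sub] := runcov_cat rs i k a [::] L.
by move: jU; rewrite -[L]cat0s E => /sub.
Qed.

Lemma runcov_prefix P i k a s :
  prefix (runcov (rects_of P) i k a (arr P k s)) (runcov (rects_of P) i k a (arr P k s.+1)).
Proof.
rewrite arrivalsS; set N := filter _ _.
by have [R -> _] := runcov_cat (rects_of P) i k a (arr P k s) N; exact: prefix_prefix.
Qed.

(** No index arrives twice, so the verdict passed on arrival is final. Hence the negative condition
    in [covered] is never revoked, and [enum_t] is a genuine enumeration. *)
Lemma runcov_stable P i k a s j : j \in arr P k s ->
  (j \in runcov (rects_of P) i k a (arr P k s.+1)) = (j \in runcov (rects_of P) i k a (arr P k s)).
Proof.
move=> jL; rewrite arrivalsS; set N := filter _ _.
have [R -> sub] := runcov_cat (rects_of P) i k a (arr P k s) N.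
rewrite mem_cat orbC; case jR: (j \in R) => //=.
by have := sub _ jR; rewrite mem_filter jL andbF.
Qed.

Lemma uncovered_prefix P k i a x s :
  prefix (uncovered U Mf P k i a x s) (uncovered U Mf P k i a x s.+1).
Proof. exact/prefix_filter/runcov_prefix. Qed.

Lemma mem_uncovered P k i a x s j : j \in uncovered U Mf P k i a x s -> j \in arr P k s.
Proof. by rewrite mem_filter => /andP[_ /mem_runcov]. Qed.

Lemma enum_t_prefix z s : prefix (enum_t U Mf l z s) (enum_t U Mf l z s.+1).
Proof.
case: z => ns P; rewrite /enum_t /=; apply: prefix_map.
rewrite /covered -/arr arrivalsS filter_cat.
rewrite [X in prefix X _](_ : _ = [seq j <- arr P (nth 0 ns 0) s | 
  all (fun i => j \notin runcov (rects_of P) i (nth 0 ns 0) (nth 0 (behead (behead ns)) i)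
     (arr P (nth 0 ns 0) s.+1)) (iota 0 l) && rthin (rects_of P) (nth 0 ns 1) j]).
  by rewrite -arrivalsS prefix_prefix.
apply: eq_in_filter => j jL; congr (_ && _); apply: eq_all => i /=.
by rewrite runcov_stable.
Qed.

Lemma labels_prefix P k i a x s : prefix (labels U Mf P k i a x s) (labels U Mf P k i a x s.+1).
Proof.
rewrite /labels [X in prefix X _](_ : _ =
   [seq odflt [::] (label Mf (rects_of P) s.+1 j) | j <- uncovered U Mf P k i a x s]).
  exact/prefix_map/uncovered_prefix.
by apply/eq_in_map => j /mem_uncovered jL; rewrite (label_arrivals jL).
Qed.

Lemma enum_y_x_prefix z s : prefix (enum_y_x U Mf z s) (enum_y_x U Mf z s.+1).
Proof. exact/heavy_prefix/labels_prefix. Qed.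

Lemma enum_t_xy_prefix z s : prefix (enum_t_xy U Mf z s) (enum_t_xy U Mf z s.+1).
Proof.
rewrite /enum_t_xy; apply: prefix_map; set P := nth _ _ 2; set Us := uncovered _ _ _ _ _ _ _.
rewrite [X in prefix X _](_ : _ = [seq j <- Us s |
   odflt [::] (label Mf (rects_of P) s.+1 j) == nth [::] (dec_seq z.2) 1]).
  exact/prefix_filter/uncovered_prefix.
by apply: eq_in_filter => j /mem_uncovered jL; rewrite (label_arrivals jL).
Qed.

End Stages.

(** * Protocols *)

Section ProtocolCode.
Variables (l : nat) (n : 'I_l -> nat) (Pi : protocol n).

Let P : word := code_protocol Pi.
Let rs : rlist := rects_of P.
Implicit Types (z : dom n) (i : 'I_l) (j : nat).

Definition rect j : {set dom n} := nth set0 (rects Pi) j.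

Definition rect_proj i j : {set (n i).-tuple bool} := [set z i | z : dom n in rect j].

Lemma rects_of_protocol :
  rs = [seq [seq (strings z : seq word) | z <- enum B] | B : {set dom n} <- rects Pi].
Proof.
rewrite /rs /rects_of /P /code_protocol code_seqK /= code_seqK -map_comp.
apply: eq_map => B /=; rewrite code_seqK -map_comp; apply: eq_map => z /=.
by rewrite code_seqK.
Qed.

Lemma size_rects_of : size rs = size (rects Pi).
Proof. by rewrite rects_of_protocol size_map. Qed.

Lemma nth_rects_of j : nth [::] rs j = [seq (strings z : seq word) | z <- enum (rect j)].
Proof.
rewrite rects_of_protocol; have [lt_j|le_j] := ltnP j (size (rects Pi)).
  by rewrite (nth_map set0).
by rewrite nth_default ?size_map // /rect nth_default // enum_set0.
Qed.

Lemma nth_strings z i : nth [::] (strings z) i = z i.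
Proof. by rewrite -tnth_nth tnth_mktuple. Qed.

Lemma strings_inj : injective (fun z : dom n => strings z : seq word).
Proof.
move=> z z' e; apply/ffunP => i; apply: val_inj => /=.
by rewrite -!nth_strings e.
Qed.

Lemma rprojE i j : perm_eq (rproj rs i j) [seq val x | x <- enum (rect_proj i j)].
Proof.
apply: uniq_perm; first exact: undup_uniq.
  by rewrite map_inj_uniq ?enum_uniq //; exact: val_inj.
move=> w; rewrite mem_undup nth_rects_of -map_comp; apply/mapP/mapP.
  move=> [z]; rewrite mem_enum => zj -> /=; exists (z i); last exact: nth_strings.
  by rewrite mem_enum; apply/imsetP; exists z.
move=> [x]; rewrite mem_enum => /imsetP[z zj ->] ->; exists z; first by rewrite mem_enum.
by rewrite /= nth_strings.
Qed.

Lemma mem_rproj i j (x : (n i).-tuple bool) : (val x \in rproj rs i j) = (x \in rect_proj i j).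
Proof. by rewrite (perm_mem (rprojE i j)) mem_map ?mem_enum //; exact: val_inj. Qed.

Lemma rhitsE i Us (x : (n i).-tuple bool) : rhits rs i Us (val x) = hits (rect_proj i) Us x.
Proof. by apply: eq_count => j; rewrite mem_rproj. Qed.

Lemma rtestE i k a Us j : rtest rs i k a Us j = uncov_test (rect_proj i) k a Us j.
Proof.
rewrite /rtest /uncov_test; congr (_ && _).
have -> : sumn [seq wt k a (rhits rs i Us x) | x <- rproj rs i j] =
    wt_set (rect_proj i) k a Us j.
  rewrite sumnE big_map (perm_big _ (rprojE i j)) big_map big_enum /wt_set /=.
  by apply: eq_bigr => x _; rewrite rhitsE.
(* An empty rectangle has no first cell and its length is read as 0; both tests then agree because
   the weight is 0 and both bounds are positive. *)
have [E|] := eqVneq (rect j) set0.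
  have -> : wt_set (rect_proj i) k a Us j = 0.
    by rewrite /wt_set /rect_proj E imset0 big_set0.
  by rewrite muln0 !muln_gt0 !expn_gt0 card_tuple card_bool expn_gt0.
rewrite nth_rects_of => /set0Pn[z zj].
have : z \in enum (rect j) by rewrite mem_enum.
case: (enum _) => // z0 e _ /=.
by rewrite nth_strings size_tuple card_tuple card_bool.
Qed.

Lemma runcovE i k a L : runcov rs i k a L = uncov (rect_proj i) k a L.
Proof.
rewrite /runcov /uncov /uncov_step; elim/last_ind: L => // L j IH.
by rewrite -cats1 !foldl_cat /= IH rtestE.
Qed.

Lemma cell_count z :
  count (fun B : seq (seq word) => (strings z : seq word) \in B) rs = cell_thickness Pi z.
Proof.
rewrite rects_of_protocol count_map; apply: eq_count => B /=.
by have /= := mem_map strings_inj (enum B) z; rewrite mem_enum.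
Qed.

Lemma rthinP r j : reflect (forall z, z \in rect j -> cell_thickness Pi z <= 2 ^ r) (rthin rs r j).
Proof.
rewrite /rthin nth_rects_of all_map; apply: (iffP allP) => H z.
  by move=> zj; rewrite -cell_count; apply: H; rewrite mem_enum.
by rewrite mem_enum => zj /=; rewrite cell_count; apply: H.
Qed.

(** Coordinates taken from different points of a rectangle lie in its factors, so they combine to a
    point of the rectangle. *)
Lemma rect_setXn j : rect j != set0 -> rect j = setXn (fun i => rect_proj i j).
Proof.
move=> n0; have lt_j : j < size (rects Pi).
  by rewrite ltnNge; apply: contra n0 => le_j; rewrite /rect nth_default.
have [A E] := rects_rectangle (mem_nth set0 lt_j).
rewrite -/(rect j) in E; have /set0Pn[z0 z0j] := n0.
apply/setP => z; rewrite in_setXn; apply/idP/forallP => [zj i|zj].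
  by apply/imsetP; exists z.
rewrite E; apply/setXnP => i; have /imsetP[z' + ->] := zj i.
by rewrite E => /setXnP.
Qed.

(** * Counting the uncovered and the covered rectangles *)

Section Counting.
Variables (U Mf : TM).

Lemma arrivals_rect k s j : j \in arrivals U Mf P k s -> rect j != set0.
Proof.
move=> /mem_arrivals /andP[_ /and3P[n0 _ _]].
by apply: contra n0 => /eqP E; rewrite -/rs nth_rects_of E enum_set0.
Qed.

Lemma size_uncovered k i a (x : (n i).-tuple bool) s :
  size (uncovered U Mf P k i a (val x) s) <= 2 ^ a * (n i + a).
Proof.
rewrite /uncovered size_filter -/rs.
rewrite -[count _ _]/(rhits rs i _ (val x)) rhitsE runcovE.
by apply: hits_uncov (size_arrivals _ _ _ _ _); rewrite card_tuple card_bool.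
Qed.

Lemma count_rect z G : uniq G -> count (fun j => z \in rect j) G <= cell_thickness Pi z.
Proof.
move=> uG; have -> : cell_thickness Pi z = count (fun j => z \in rect j) (iota 0 (size (rects Pi))).
  rewrite /cell_thickness -[in LHS](take_size (rects Pi)) -(map_nth_iota0 set0) //.
  by rewrite count_map.
rewrite -!size_filter; apply: uniq_leq_size; first exact: filter_uniq.
move=> j; rewrite !mem_filter mem_iota add0n /= => /andP[zj _]; rewrite zj /=.
by rewrite ltnNge; apply: contraTN zj => le_j; rewrite /rect nth_default // inE.
Qed.

(** A covered rectangle has at least a [2^(sum a_i - l(k+1))] fraction of the total product weight,
    while double counting bounds the sum over all of [G] by [2^r] times the total. The factor 2 of
    [covering_weights], once per party, turns [k] into [k.+1]. *)
Lemma size_covered k r aa s :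
  size (covered U Mf l P k r aa s) * 2 ^ (\sum_(i < l) nth 0 aa i) <= 2 ^ (l * k.+1 + r).
Proof.
set G := covered _ _ _ _ _ _ _ _.
pose L := arrivals U Mf P k s.
have uG : uniq G by rewrite filter_uniq // uniq_arrivals.
have GP j : j \in G -> [/\ j \in L, rthin rs r j &
    forall i, j \notin uncov (rect_proj i) k (nth 0 aa i) L].
  rewrite mem_filter => /andP[/andP[/allP cov thin] jL]; split=> // i.
  by rewrite -runcovE; apply: cov; rewrite mem_iota add0n ltn_ord.
have [G0|G0] := posnP (size G); first by rewrite G0.
(* [covering_weights] requires at least one arrival, which a nonempty [G] provides. *)
have L0 : 0 < size L.
  by apply: leq_trans G0 _; rewrite size_filter count_size.
have [i|W HW] := @fin_all_exists 'I_l (fun i => (n i).-tuple bool -> nat)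
   (fun i W => 0 < \sum_x W x /\
      forall j, j \in L -> j \notin uncov (rect_proj i) k (nth 0 aa i) L ->
      2 ^ nth 0 aa i * \sum_x W x <= 2 ^ k.+1 * \sum_(x in rect_proj i j) W x).
  apply: covering_weights => //; first exact: size_arrivals.
  move=> j /arrivals_rect /set0Pn[z zj]; apply/set0Pn; exists (z i).
  by apply/imsetP; exists z.
have tot0 : 0 < \prod_i \sum_x W i x by rewrite prodn_gt0 // => i; have [] := HW i.
have rectE j : j \in G -> setXn (fun i => rect_proj i j) = rect j.
  by move=> /GP[jL _ _]; rewrite -rect_setXn // (arrivals_rect jL).
have : \sum_(j <- G) \prod_i \sum_(x in rect_proj i j) W i x <= 2 ^ r * \prod_i \sum_x W i x.
  apply: weighted_rect_count => j jG z; rewrite (rectE _ jG) => zj.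
  have /GP[_ /rthinP thin _] := jG; apply: leq_trans (thin _ zj).
  rewrite (@eq_in_count _ _ (fun j' => z \in rect j')); first exact: count_rect.
  by move=> j' j'G /=; rewrite rectE.
move=> le_sum; rewrite -(leq_pmul2r tot0) expnD -[leqRHS]mulnA.
apply: leq_trans (leq_mul (leqnn (2 ^ (l * k.+1))) le_sum).
rewrite -sum1_size big_distrl /= big_distrr big_distrl /= big_seq [leqRHS]big_seq.
apply: leq_sum => j jG; rewrite mul1n.
have [jL _ cov] := GP _ jG.
have -> : 2 ^ (\sum_(i < l) nth 0 aa i) = \prod_(i < l) 2 ^ nth 0 aa i.
  by rewrite (big_morph _ (expnD 2) (expn0 2)).
have -> : 2 ^ (l * k.+1) = \prod_(i < l) 2 ^ k.+1.
  by rewrite prod_nat_const card_ord -expnM mulnC.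
rewrite -!big_split /=; apply: leq_prod => i _; have [_ H] := HW i.
exact: H.
Qed.

End Counting.
End ProtocolCode.

(** * Lengths of programs and arithmetic of the error terms *)

Lemma trunc_log2_leq q e : q < 2 ^ e.+1 -> trunc_log 2 q <= e.
Proof.
have [->|q0] := posnP q; first by [].
move=> lt_q; rewrite -ltnS -(ltn_exp2l _ _ (isT : 1 < 2)).
exact: leq_ltn_trans (@trunc_logP 2 q isT q0) lt_q.
Qed.

Lemma size_code_bits w : size (code_bits w) = (size w).*2.+1.
Proof.
rewrite size_rcons size_flatten /shape -map_comp (eq_map (g := fun=> 2)) //.
by congr S; elim: w => //= b w ->; rewrite doubleS.
Qed.

(** Each parameter is linear in [N] and costs O(log N) bits, doubled by each of the two levels of
    self-delimiting code. As the logarithm of [N.+2] is at least 1, additive constants go into its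
    coefficient. *)
Lemma size_enum_program (ns : seq nat) q B N : all (fun v => v <= B * N.+2) ns ->
  size (enum_program ns q) <=
    (size ns * (4 * trunc_log 2 B + 14) + 2) * trunc_log 2 N.+2 + trunc_log 2 q.
Proof.
move=> le_ns; set lam := trunc_log 2 N.+2; set mu := trunc_log 2 B.
have lam1 : 1 <= lam by apply: trunc_log_max.
have le_v v : v <= B * N.+2 -> trunc_log 2 v <= mu + lam + 1.
  move=> le_v; apply: trunc_log2_leq; apply: leq_ltn_trans le_v _.
  have -> : (mu + lam + 1).+1 = mu.+1 + lam.+1 by lia.
  by rewrite expnD; apply: ltn_mul; apply: trunc_log_ltn.
rewrite size_cat size_code_bits size_code_nat.
have : size (code_seq [seq code_nat k | k <- ns]) <= size ns * (2 * (mu + lam + 1) + 3).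
  elim: ns le_ns => // v ns IH /andP[/le_v Hv /IH {}IH].
  rewrite map_cons -[code_seq (_ :: _)]/(code_bits _ ++ code_seq _).
  rewrite size_cat size_code_bits size_code_nat -muln2 -[size (_ :: _)]/(size ns).+1 mulSn.
  by apply: leq_add => //; lia.
set S := size (code_seq _); set m := size ns; set t := trunc_log 2 q.
move=> le_S; rewrite -muln2; nia.
Qed.

Lemma card_index_leq (T : eqType) (x : T) (s : seq T) e :
  x \in s -> size s <= 2 ^ e -> trunc_log 2 (index x s) <= e.
Proof.
rewrite -index_mem => lt_s le_s; apply: trunc_log2_leq.
by apply: leq_trans (leq_trans lt_s le_s) _; rewrite leq_exp2l.
Qed.

(** The slack exceeds the cost of [m] parameters plus the logarithm of the polynomial factor in the
    count of uncovered rectangles, which is [mu + lam + 2]. *)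
Lemma slack_bound kap mu c c' m lam : m <= 4 -> 0 < lam ->
  (m * kap + 2) * lam + (mu + lam + 2) + c < (4 * kap + mu + c + c' + 6) * lam.
Proof.
move=> m4 lam0; have := leq_pmulr mu lam0; have := leq_pmulr c lam0.
have := leq_mul (leq_mul m4 (leqnn kap)) (leqnn lam); rewrite !mulnDl.
move: (mu * lam) (c * lam) (c' * lam) (m * kap * lam) (4 * kap * lam) => *; lia.
Qed.

(** Here [S] stands for the sum of all [b_i + d_i], [A] for the sum of the rates, and [e] for the
    logarithm of the index of the transcript. *)
Lemma collect_bounds S A k l e r c lam D kl : 0 < lam ->
  k <= (kl + 2) * lam + e + c -> e + A <= l * k.+1 + r -> S <= A + l * (2 * (D * lam)) ->
  S + k <= l * k + r + (2 * l * D + kl + 2 + c + l) * lam.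
Proof.
move=> lam0; have := leq_pmulr c lam0; have := leq_pmulr l lam0.
have -> : l * (2 * (D * lam)) = 2 * l * D * lam by rewrite !mulnA [l * 2]mulnC.
rewrite !mulnDl mulnS.
move: (l * k) (l * lam) (c * lam) (kl * lam) (2 * l * D * lam) => *; lia.
Qed.

(** * The inequality over the natural numbers *)

Section Main.
Variables (U : universalTM) (l : nat) (f : l.-tuple bits -> bits) (Mf : TM).
Hypothesis Mf_f : forall xs : l.-tuple bits, tm_eval Mf xs (f xs).
Hypothesis l_gt0 : 0 < l.

(** At a late stage a shortest program for the index and the machine of [f] have both halted. The
    label is computed on the first cell of the rectangle, where [f] has the same value as at [x]
    because the protocol computes [f]. *)
Lemma transcript_arrives (n : 'I_l -> nat) (Pi : protocol n) (x : dom n) :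
  computes Pi f ->
  let P := code_protocol Pi in
  let j := index (transcript Pi x) (rects Pi) in
  exists s, j \in arrivals U Mf P (C U (code_nat j) P) s /\
    label Mf (rects_of P) s j = Some (f (strings x)).
Proof.
move=> cPi P j; pose T := transcript Pi x.
have jT : rect Pi j = T by rewrite /rect nth_index // transcript_rects.
have lt_j : j < size (rects_of P) by rewrite size_rects_of index_mem transcript_rects.
have [p size_p /tm_eval_stage [s1 H1]] := C_program U (code_nat j) P.
have xT : x \in enum T by rewrite mem_enum transcript_mem.
have En : nth [::] (rects_of P) j = [seq (strings z : seq word) | z <- enum T].
  by rewrite nth_rects_of jT.
have [z0 [e [Ee z0T]]] : exists z0 e, enum T = z0 :: e /\ z0 \in T.
  case E: (enum T) xT => [//|z0 e] _; exists z0, e; split=> //.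
  by rewrite -mem_enum E inE eqxx.
have fz0 : f (strings z0) = f (strings x).
  by apply: cPi (transcript_rects Pi x) _ _ z0T (transcript_mem _ _).
have [s2 H2] := tm_eval_stage (Mf_f (strings z0)).
pose s := maxn s1 s2; exists s.+1.
have lab s' : s <= s' -> label Mf (rects_of P) s' j = Some (f (strings x)).
  by move=> le_s; rewrite /label En Ee /= H2 ?fz0 // (leq_trans (leq_maxr _ _) le_s).
split; last exact: lab.
apply: arrivals_mem => //; apply/and3P; split; first by rewrite En Ee.
  by rewrite lab.
apply/hasP; exists p; first by rewrite -size_p mem_all_words.
by rewrite H1 // leq_maxl.
Qed.

(** The claim multiplied by [l - 1], with terms moved across so that no subtraction occurs and with
    the logarithm of the thickness rounded up. *)
Lemma complexity_bound : exists c, forall (n : 'I_l -> nat) (Pi : protocol n),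
  computes Pi f -> forall x : dom n,
  let T := transcript Pi x in
  let t := code_index Pi T in
  let y := f (strings x) in
  let P := code_protocol Pi in
  let N := maxn (\max_(i < l) size (x i)) (maxn (size y) (size t)) in
  is_true (\sum_(i < l) C U y (code_seq [:: tval (x i); P])
    + \sum_(i < l) C U t (code_seq [:: tval (x i); y; P]) + C U t P
  <= l * C U t P + up_log 2 (thickness Pi T) + c * trunc_log 2 N.+2).
Proof.
have [cS HcS] := C_le_size U.
have [c0 Hc0] := C_enum U (cpt_enum_t U Mf l).
have [c1 Hc1] := C_enum U (cpt_enum_y_x U Mf).
have [c2 Hc2] := C_enum U (cpt_enum_t_xy U Mf).
(* [B] makes every program parameter at most [B * N.+2]; the factor [l.+1] takes care of the index
   [i] and of [r]. *)
pose B := l.+1 * (2 * cS + 3).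
pose mu := trunc_log 2 B.
pose kap := 4 * mu + 14.
pose D := 4 * kap + mu + c1 + c2 + 6.
exists (2 * l * D + l.+2 * kap + 2 + c0 + l) => n Pi cPi x T t y P N.
set lam := trunc_log 2 N.+2; set k := C U t P.
have lam1 : 1 <= lam by apply: trunc_log_max.
pose b i := C U y (code_seq [:: tval (x i); P]).
pose d i := C U t (code_seq [:: tval (x i); y; P]).
rewrite -/(\sum_(i < l) b i) -/(\sum_(i < l) d i).
set r := up_log 2 _.
have le_yN : size y <= N by rewrite /N leq_max leq_maxl orbT.
have le_tN : size t <= N by rewrite /N leq_max leq_maxr orbT.
have le_xN i : n i <= N.
  rewrite /N leq_max; apply/orP; left.
  by apply: leq_trans (leq_bigmax i); rewrite size_tuple.
have le_k : k <= N + cS by apply: leq_trans (HcS _ _) _; rewrite leq_add2r.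
have le_b i : b i <= N + cS by apply: leq_trans (HcS _ _) _; rewrite leq_add2r.
have le_d i : d i <= N + cS by apply: leq_trans (HcS _ _) _; rewrite leq_add2r.
(* If [r] is at least the whole sum, the claim is immediate; otherwise [r] is linear in [N] and so
   cheap as a parameter. *)
have [le_r|lt_r] := leqP (\sum_(i < l) b i + \sum_(i < l) d i) r.
  have : k <= l * k by rewrite leq_pmull.
  lia.
have le_sum : \sum_(i < l) b i + \sum_(i < l) d i <= l * (2 * (N + cS)).
  rewrite -big_split /= -[X in _ <= X * _]card_ord -sum_nat_const; apply: leq_sum => i _.
  by have := le_b i; have := le_d i; lia.
pose dl := D * lam.
(* Truncated subtraction: [b i <= bb i + dl] always, with equality once [bb i] is positive, and
   likewise for [dd]. *)
pose bb i := b i - dl; pose dd i := d i - dl; pose a i := bb i + dd i.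
have bnd v : v <= 3 * N + 2 * cS -> v <= B * N.+2.
  by rewrite /B; move: l_gt0; move=> *; nia.
have le_a i : a i <= 2 * N + 2 * cS.
  by have := le_b i; have := le_d i; rewrite /a /bb /dd; lia.
have [s [jL lab]] := transcript_arrives x cPi.
rewrite -/P -/T -/(code_index Pi T) -/t -/k -/y in jL lab.
set j := index T (rects Pi) in jL lab.
have jT : rect Pi j = T by rewrite /rect nth_index // transcript_rects.
have xT : x \in rect Pi j by rewrite jT transcript_mem.
(* If the transcript were uncovered for party [i], one of the two descriptions below would be
   shorter than [d i] or [b i]. *)
have cov (i : 'I_l) : j \notin runcov (rects_of P) i k (a i) (arrivals U Mf P k s).
  apply/negP => jU.
  have a_gt0 : 0 < a i.
    by rewrite lt0n; apply/negP => /eqP a0; move: jU; rewrite /P runcovE uncov_a0.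
  pose Us := uncovered U Mf P k i (a i) (x i) s.
  have jUs : j \in Us.
    rewrite mem_filter jU andbT mem_rproj; apply/imsetP; by exists x.
  pose lb j' := odflt [::] (label Mf (rects_of P) s j').
  have lbj : lb j = y by rewrite /lb lab.
  pose Vy := [seq j' <- Us | lb j' == y].
  have jVy : j \in Vy by rewrite mem_filter lbj eqxx.
  have szU : size Us <= 2 ^ (a i + (mu + lam + 2)).
    apply: leq_trans (size_uncovered _ _ _ _ _ _ _) _.
    rewrite expnD leq_mul2l; apply/orP; right.
    have : n i + a i <= B * N.+2 by apply: bnd; have := le_xN i; have := le_a i; lia.
    move=> /leq_trans; apply; have -> : mu + lam + 2 = mu.+1 + lam.+1 by lia.
    by rewrite expnD; apply: leq_mul; apply: ltnW; apply: trunc_log_ltn.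
  have lt_l : i <= B * N.+2.
    by have := ltn_ord i; rewrite /B; nia.
  have le_kB : k <= B * N.+2 by apply: bnd; lia.
  have le_aB : a i <= B * N.+2 by apply: bnd; have := le_a i; lia.
  have le_ddB : dd i <= B * N.+2 by apply: bnd; have := le_d i; rewrite /dd; lia.
  (* First description: [t] by its position among the uncovered rectangles through [x_i] with label
     [y]. *)
  have tP e : size Vy <= 2 ^ e -> d i <= (3 * kap + 2) * lam + e + c2.
    move=> le_e; set ns := [:: k; nat_of_ord i; a i].
    have El : enum_t_xy U Mf (ns, code_seq [:: tval (x i); y; P]) s = map code_nat Vy.
      by rewrite /enum_t_xy /= code_seqK.
    have t_in : t \in enum_t_xy U Mf (ns, code_seq [:: tval (x i); y; P]) s.
      by rewrite El; apply: map_f.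
    have /(_ (enum_t_xy_prefix _ _ _)) := Hc2 ns (code_seq [:: tval (x i); y; P]) s t.
    move=> /(_ t_in) /leq_trans; apply; rewrite leq_add2r.
    apply: leq_trans (@size_enum_program _ _ B N _) _; first by rewrite /= le_kB lt_l le_aB.
    by rewrite leq_add2l; apply: card_index_leq; rewrite // El size_map.
  (* Second description: [y] by its position among the labels shared by at least [2^(dd i)] of the
     rectangles in [Us]; at most [2^e] labels are that frequent. *)
  have yP e : 2 ^ dd i <= size Vy -> size Us <= 2 ^ (dd i + e) -> b i <= (4 * kap + 2) * lam + e + c1.
    move=> ge_V le_e; set ns := [:: k; nat_of_ord i; a i; dd i].
    have El : enum_y_x U Mf (ns, code_seq [:: tval (x i); P]) s = heavy (2 ^ dd i) (map lb Us).
      by rewrite /enum_y_x /= code_seqK.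
    have h0 : 0 < 2 ^ dd i by rewrite expn_gt0.
    have y_in : y \in enum_y_x U Mf (ns, code_seq [:: tval (x i); P]) s.
      rewrite El mem_heavy // count_map; apply: leq_trans ge_V _.
      by rewrite size_filter; apply: sub_count.
    have /(_ (enum_y_x_prefix _ _ _)) := Hc1 ns (code_seq [:: tval (x i); P]) s y.
    move=> /(_ y_in) /leq_trans; apply; rewrite leq_add2r.
    apply: leq_trans (@size_enum_program _ _ B N _) _.
      by rewrite /= le_kB lt_l le_aB le_ddB.
    rewrite leq_add2l; apply: card_index_leq; rewrite // El.
    rewrite -(leq_pmul2l h0) -expnD.
    by apply: leq_trans (size_heavy _ h0) _; rewrite size_map.
  have le_V : size Vy <= size Us by rewrite size_filter count_size.
  have V0 : 0 < size Vy by case: (Vy) jVy.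
  have big1 : (4 * kap + 2) * lam + (mu + lam + 2) + c1 < dl.
    by apply: leq_trans (slack_bound kap mu c1 c2 (leqnn 4) lam1) _; rewrite /dl /D.
  have big2 : (3 * kap + 2) * lam + (mu + lam + 2) + c2 < dl.
    apply: leq_trans (slack_bound kap mu c2 c1 (isT : 3 <= 4) lam1) _.
    by rewrite /dl /D -[_ + c2 + c1]addnA [c2 + c1]addnC addnA.
  (* With [bb i = 0] the rate equals [dd i], so the bound on all of [Us] already makes the first
     description too short. *)
  have [b0|b_gt0] := posnP (bb i).
    have Ed : d i = dd i + dl by move: a_gt0; rewrite /a b0 add0n /dd; lia.
    have Ea : a i = dd i by rewrite /a b0.
    by have := tP _ (leq_trans le_V szU); rewrite Ea Ed; lia.
  have Eb : b i = bb i + dl by move: b_gt0; rewrite /bb; lia.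
  have [lt_V|ge_V] := ltnP (size Vy) (2 ^ dd i).
    (* With [dd i = 0] there would be no rectangle labelled [y], but [j] is one. *)
    have [d0|d_gt0] := posnP (dd i); first by move: lt_V; rewrite d0; lia.
    have Ed : d i = dd i + dl by move: d_gt0; rewrite /dd; lia.
    by have := tP _ (ltnW lt_V); rewrite Ed; lia.
  have := yP (bb i + (mu + lam + 2)) ge_V; rewrite addnA [dd i + _]addnC -/(a i).
  by move=> /(_ szU); rewrite Eb; lia.
pose aa := [seq a i | i <- enum 'I_l].
have aaE (i : 'I_l) : nth 0 aa i = a i by rewrite (nth_map i) ?size_enum_ord // nth_ord_enum.
pose G := covered U Mf l P k r aa s.
have jG : j \in G.
  rewrite mem_filter jL andbT; apply/andP; split.
    apply/allP => i; rewrite mem_iota add0n /= => lt_i.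
    by have := cov (Ordinal lt_i); rewrite -aaE.
  apply/rthinP => z; rewrite jT => zT.
  apply: leq_trans (up_logP _ (isT : 1 < 2)).
  exact: (@leq_bigmax_cond _ (mem T) (cell_thickness Pi)).
pose ns := [:: k, r & aa].
have El : enum_t U Mf l (ns, P) s = map code_nat G by [].
have t_in : t \in enum_t U Mf l (ns, P) s by rewrite El; apply: map_f.
set q := index t (enum_t U Mf l (ns, P) s).
have le_kq : k <= (l.+2 * kap + 2) * lam + trunc_log 2 q + c0.
  have /(_ (enum_t_prefix _ _ _ _)) := Hc0 ns P s t.
  move=> /(_ t_in) /leq_trans; apply; rewrite leq_add2r -/q.
  apply: leq_trans (@size_enum_program _ _ B N _) _.
    rewrite /= bnd ?andTb; last by lia.
    apply/andP; split; first by move: (ltnW (leq_trans lt_r le_sum)); rewrite /B; nia.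
    by apply/allP => _ /mapP[i _ ->]; apply: bnd; have := le_a i; lia.
  by rewrite /= size_map size_enum_ord.
have lt_q : q < size G by rewrite -[size G](size_map code_nat) -El index_mem.
(* For index 0 the logarithm is 0 by convention, and the bound holds because [G] contains [j]. *)
have le_e : 2 ^ trunc_log 2 q <= size G.
  have [->|q0] := posnP q; first by rewrite trunc_log0 expn0; lia.
  by apply: leq_trans (@trunc_logP 2 q isT q0) (ltnW lt_q).
have := size_covered Pi U Mf k r aa s; rewrite -/P -/G => le_G.
have {le_G}: trunc_log 2 q + \sum_(i < l) a i <= l * k.+1 + r.
  rewrite -(leq_exp2l _ _ (isT : 1 < 2)) expnD; apply: leq_trans le_G.
  by under eq_bigr do rewrite -aaE; rewrite leq_mul2r le_e orbT.
have : \sum_(i < l) b i + \sum_(i < l) d i <= \sum_(i < l) a i + l * (2 * dl).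
  rewrite -big_split /= -[X in _ + X * _]card_ord -sum_nat_const -big_split /=.
  by apply: leq_sum => i _; rewrite /a /bb /dd; lia.
by move=> H1 H2; apply: collect_bounds lam1 le_kq H2 H1.
Qed.

End Main.

(** * Passage to real numbers *)

Import Order.TTheory GRing.Theory Num.Theory.

Local Open Scope ring_scope.

Lemma log2_expn_leq (R : realType) (e m : nat) :
  (2 ^ e <= m)%N -> e%:R <= log2 (m%:R : R).
Proof.
move=> le_m; have ln2 : 0 < ln (2 : R) by rewrite ln_gt0 // ltr1n.
rewrite /log2 ler_pdivlMr // mulr_natl -lnXn ?ltr0n //.
rewrite ler_ln ?posrE ?exprn_gt0 ?ltr0n //; first by rewrite -natrX ler_nat.
by apply: leq_trans le_m; rewrite expn_gt0.
Qed.

Lemma up_log2_leq (R : realType) (m : nat) :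
  (0 < m)%N -> (up_log 2 m)%:R <= log2 (m%:R : R) + 1.
Proof.
move=> m0; case E: (up_log 2 m) => [|e].
  by rewrite addr_ge0 // (le_trans _ (@log2_expn_leq R 0 m _)).
rewrite -natr1 lerD2r; apply: log2_expn_leq; apply: ltnW.
rewrite ltnNge; apply/negP => le_m.
by have := up_log_min (isT : (1 < 2)%N) le_m; rewrite E ltnn.
Qed.

Theorem theorem7p2 (R : realType) (U : universalTM) (l : nat)
    (f : l.-tuple bits -> bits) :
  (2 <= l)%N -> computable f ->
  exists c : R, forall (n : 'I_l -> nat) (Pi : protocol n),
    computes Pi f ->
    forall x : dom n,
      let T := transcript Pi x in
      let t := code_index Pi T in
      let y := f (strings x) in
      let P := code_protocol Pi in
      let N := maxn (\max_(i < l) size (x i)) (maxn (size y) (size t)) in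
      (C U t P)%:R >=
        (l%:R - 1)^-1 *
          (\sum_(i < l) (C U y (code_seq [:: tval (x i); P]))%:R
           + \sum_(i < l) (C U t (code_seq [:: tval (x i); y; P]))%:R
           - log2 (thickness Pi T)%:R)
        - c * log2 (N + 2)%N%:R.
Proof.
move=> l2 [Mf HMf].
have [c Hc] := @complexity_bound U l f Mf HMf (ltnW l2).
(* The additional unit pays for rounding up the logarithm of the thickness, an error of at most 1,
   which is at most [log2 (N + 2)]. *)
exists (c.+1%:R) => n Pi cPi x; have := Hc n Pi cPi x; cbv zeta.
set T := transcript Pi x; set t := code_index Pi T; set y := f (strings x).
set P := code_protocol Pi; set N := maxn _ _; rewrite addn2.
set Sb := (\sum_(i < l) C U y _)%N; set Sd := (\sum_(i < l) C U t _)%N.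
set k := C U t P; set rho := thickness Pi T => le_nat.
rewrite -!natr_sum -/Sb -/Sd.
have rho0 : (0 < rho)%N.
  apply: leq_trans (@leq_bigmax_cond _ (mem T) (cell_thickness Pi) x _); last exact: transcript_mem.
  rewrite -has_count; apply/hasP; exists T; first exact: transcript_rects.
  exact: transcript_mem.
have := up_log2_leq R rho0; set lr := log2 rho%:R => le_r.
have le_lam : (trunc_log 2 N.+2)%:R <= log2 (N.+2%:R : R).
  by apply: log2_expn_leq; apply: trunc_logP.
have le_1 : 1 <= log2 (N.+2%:R : R) by apply: (@log2_expn_leq R 1).
set lam := log2 _ in le_lam le_1 *.
have l1 : 1 <= l%:R - 1 :> R by rewrite lerBrDr -(natrD _ 1 1) ler_nat.
have l0 : 0 < l%:R - 1 :> R by apply: lt_le_trans l1.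
have main : Sb%:R + Sd%:R - lr <= (l%:R - 1) * k%:R + c.+1%:R * lam.
  move: le_nat; rewrite -(ler_nat R) !natrD !natrM => le_nat.
  have le_c : c%:R * (trunc_log 2 N.+2)%:R <= c%:R * lam by rewrite ler_wpM2l.
  rewrite -natr1; lra.
(* Since [l >= 2], the inverse of [l - 1] is at most 1, so the division does not enlarge the error
   term. *)
rewrite lerBlDr; apply: le_trans (_ : (l%:R - 1)^-1 * ((l%:R - 1) * k%:R + c.+1%:R * lam) <= _).
  by rewrite ler_wpM2l // invr_ge0 ltW.
rewrite mulrDr mulKf ?gt_eqF // lerD2l ler_piMl //.
  by rewrite mulr_ge0 // (le_trans _ le_1).
by rewrite invf_le1.
Qed.
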